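(* Let $\Lambda$ be the weight lattice of a semisimple root system with Weyl group $W$ and fundamental weights $\omega_1,\ldots,\omega_n$ (a $\mathbb{Z}$-basis of $\Lambda$), and let $T^*\subset\Lambda$ be a subgroup of index $2$ (the character lattice of a split maximal torus of the corresponding group $G$). Use the notation $n'$, $s_j$, $d_i$, $d$, $a_{i,j}$, $\rho(\omega_i)$, $\rho_i$, $\tilde\rho_i$, $\tilde\rho(\omega_i)$, $\lambda_0$, $r_i$, $h_{1,i},h_{2,i},h_{3,i}$ and $I^W_{sc}$ described in the context. Assume that the $n$-tuple $(\rho_1,\ldots,\rho_n)$ satisfies the generalized flatness condition (over $R=\mathbb{Z}$) with respect to some $\mathbb{Z}$-basis $\{x_1,\ldots,x_n\}$ of $\Lambda$. Then the elements $$h_{1,i}\ (1\le i<n'),\qquad h_{2,i}\ (1\le i\le n'),\qquad h_{3,i}\ (n'<i\le n)$$ generate the ideal $I^W_{sc}\cap\mathbb{Z}[T^*]$ of the ring $\mathbb{Z}[T^*]$.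
   Context: For a ring $R$ (here $R=\mathbb{Z}$ or $\mathbb{Z}/m\mathbb{Z}$, $m\ge 2$) and a free abelian group $\Lambda$ with basis $x_1,\ldots,x_n$, $R[\Lambda]$ is the group ring, identified with the Laurent polynomial ring $R[x_1^{\pm1},\ldots,x_n^{\pm1}]$; $\Lambda_i$ denotes the subgroup spanned by $x_1,\ldots,x_i$. A polynomial $p\in R[\Lambda_i]$ is a divisor with respect to $x_i$ if, writing $p=p_kx_i^k+\cdots+p_mx_i^m$ with $p_j\in R[\Lambda_{i-1}]$, $p_k\neq0$, the leading coefficient $p_k$ is a monic monomial in $x_1,\ldots,x_{i-1}$ (coefficient $1$). An $n$-tuple $(q_1,\ldots,q_n)$ satisfies the flatness condition if $q_i\in R[\Lambda_i]$ and $q_i$ is a divisor with respect to $x_i$ for each $i$; it satisfies the generalized flatness condition if there is $A\in GL_n(R[\Lambda])$ such that $(q_1,\ldots,q_n)A$ satisfies the flatness condition. Grading: each $\lambda\in\Lambda$ has degree $|\lambda|\in\Lambda/T^*=\mathbb{Z}/2\mathbb{Z}$; $\Lambda^{(0)}=T^*$, $\Lambda^{(1)}=\Lambda\setminus T^*$. After reindexing, $\omega_1,\ldots,\omega_{n'}\notin T^*$ and $\omega_{n'+1},\ldots,\omega_n\in T^*$. Put $s_j=|W(\omega_j)|$ (size of the $W$-orbit), $\rho(\omega_j)=\sum_{\lambda\in W(\omega_j)}e^{\lambda}\in\mathbb{Z}[\Lambda]$, $\rho_j=\rho(\omega_j)-s_j$. For $1\le i\le n'$ let $d_i=\gcd(s_i,s_{i+1},\ldots,s_{n'})$,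 $d=d_1$, and fix integers $a_{i,j}$ ($i\le j\le n'$) with $d_i=\sum_{j=i}^{n'}a_{i,j}s_j$; set $\tilde\rho_i=\sum_{j=i}^{n'}a_{i,j}\rho_j$ and $\tilde\rho(\omega_i)=\tilde\rho_i+d_i$. Fix $\lambda_0\in\Lambda^{(1)}$. Define, for $1\le i<n'$ with $r_i=\operatorname{lcm}(s_i,d_{i+1})$, $h_{1,i}=e^{\lambda_0}\big(\tfrac{r_i}{s_i}\rho(\omega_i)-\tfrac{r_i}{d_{i+1}}\tilde\rho(\omega_{i+1})\big)$; for $1\le i\le n'$, $h_{2,i}=\rho(\omega_i)\tilde\rho(\omega_1)-d s_i$; for $n'<i\le n$, $h_{3,i}=\rho_i$. These lie in $\mathbb{Z}[T^*]$. $I^W_{sc}$ is the ideal of $\mathbb{Z}[\Lambda]$ generated by the $W$-invariant elements of the augmentation ideal (kernel of $\mathbb{Z}[\Lambda]\to\mathbb{Z}$, $e^\lambda\mapsto1$). *)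

(* Defs.v *)
From HB Require Import structures.
From mathcomp Require Import all_boot all_order all_algebra.
From mathcomp Require Import finmap.
From mathcomp.multinomials Require Import monalg.
From Stdlib Require Import ClassicalEpsilon.
Set Implicit Arguments. Unset Strict Implicit. Unset Printing Implicit Defensive.
Import GRing.Theory.
Local Open Scope fset_scope.
Local Open Scope ring_scope.

Definition grpalg (K : zmodType) (R : comRingType) := {malg R[K]}.
HB.instance Definition _ K R := GRing.Zmodule.on (grpalg K R).
HB.instance Definition _ K R := Choice.on (grpalg K R).

Section GrpAlg.
Context (K : zmodType) (R : comRingType).
Implicit Types (g : grpalg K R).

Definition gaone : grpalg K R := << 0%R >>.
Definition gamul_def g1 g2 : grpalg K R :=
  \sum_(k1 <- msupp g1) \sum_(k2 <- msupp g2) << g1@_k1 * g2@_k2 *g (k1 + k2) >>.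

Fact gamul_key : unit. Proof. by []. Qed.
Definition gamul := locked_with gamul_key gamul_def.
Lemma gamulE g1 g2 : gamul g1 g2 =
  \sum_(k1 <- msupp g1) \sum_(k2 <- msupp g2) << g1@_k1 * g2@_k2 *g (k1 + k2) >>.
Proof. by rewrite [gamul]unlock. Qed.

Lemma gamulw (d1 d2 : {fset K}) g1 g2 :
  msupp g1 `<=` d1 -> msupp g2 `<=` d2 ->
  gamul g1 g2 = \sum_(k1 <- d1) \sum_(k2 <- d2) << g1@_k1 * g2@_k2 *g (k1 + k2) >>.
Proof.
move=> le_d1 le_d2; rewrite gamulE (big_fset_incl _ le_d1) /=.
  apply/eq_bigr=> k1 _; apply/big_fset_incl => // k _ /mcoeff_outdom ->.
  by rewrite mulr0 monalgU0.
move=> k _ /mcoeff_outdom g1k.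
by rewrite big1 => // k' _; rewrite g1k mul0r monalgU0.
Qed.

Lemma gamul0g g : gamul 0 g = 0.
Proof. by rewrite gamulE msupp0 big_seq_fset0. Qed.
Lemma gamulg0 g : gamul g 0 = 0.
Proof. by rewrite gamulE exchange_big msupp0 big_seq_fset0. Qed.

Lemma gamulUU c1 c2 k1 k2 :
  gamul << c1 *g k1 >> << c2 *g k2 >> = << c1 * c2 *g (k1 + k2) >>.
Proof. by rewrite (gamulw msuppU_le msuppU_le) !big_seq_fset1 !mcoeffUU. Qed.

Lemma gamulDl g1 g2 g : gamul (g1 + g2) g = gamul g1 g + gamul g2 g.
Proof.
rewrite [in RHS](@gamulw _ (msupp g) g1 g (fsubsetUl _ (msupp g2)) (fsubset_refl _)).
rewrite [in RHS](@gamulw _ (msupp g) g2 g (fsubsetUr (msupp g1) _) (fsubset_refl _)).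
rewrite (@gamulw _ (msupp g) _ g (msuppD_le _ _) (fsubset_refl _)).
rewrite -big_split /=; apply/eq_bigr=> k1 _.
rewrite -big_split /=; apply/eq_bigr=> k2 _.
by rewrite mcoeffD mulrDl monalgUD.
Qed.

Lemma gamulC g1 g2 : gamul g1 g2 = gamul g2 g1.
Proof.
rewrite !gamulE exchange_big; apply/eq_bigr=> k1 _; apply/eq_bigr=> k2 _.
by rewrite mulrC addrC.
Qed.

Lemma gamulDr g g1 g2 : gamul g (g1 + g2) = gamul g g1 + gamul g g2.
Proof. by rewrite !(gamulC g) gamulDl. Qed.

Lemma gamul_suml (I : Type) (r : seq I) (F : I -> grpalg K R) g :
  gamul (\sum_(i <- r) F i) g = \sum_(i <- r) gamul (F i) g.
Proof. exact: (big_morph (gamul^~ g) (fun a b => gamulDl a b g) (gamul0g g)). Qed.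
Lemma gamul_sumr (I : Type) (r : seq I) (F : I -> grpalg K R) g :
  gamul g (\sum_(i <- r) F i) = \sum_(i <- r) gamul g (F i).
Proof. exact: (big_morph (gamul g) (fun a b => gamulDr g a b) (gamulg0 g)). Qed.

Lemma gamulA g1 g2 g3 : gamul g1 (gamul g2 g3) = gamul (gamul g1 g2) g3.
Proof.
have E (g : grpalg K R) : g = \sum_(k <- msupp g) << g@_k *g k >> := monalgE g.
rewrite [g1 in LHS]E [g1 in RHS]E !gamul_suml; apply: eq_bigr => k1 _.
rewrite [g2 in LHS]E [g2 in RHS]E gamul_suml gamul_sumr gamul_sumr gamul_suml.
apply: eq_bigr => k2 _.
rewrite gamulUU [g3 in LHS]E [g3 in RHS]E !gamul_sumr; apply: eq_bigr => k3 _.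
by rewrite !gamulUU mulrA addrA.
Qed.

Lemma gamul1g g : gamul gaone g = g.
Proof.
rewrite /gaone [in LHS](monalgE g) gamul_sumr [RHS]monalgE.
by apply/eq_bigr=> k _; rewrite gamulUU mul1r add0r.
Qed.
Lemma gamulg1 g : gamul g gaone = g.
Proof. by rewrite gamulC gamul1g. Qed.

Lemma gaone_neq0 : gaone != 0.
Proof. by apply/eqP/malgP=> /(_ 0%R) /eqP; rewrite mcoeffUU mcoeff0 oner_eq0. Qed.

HB.instance Definition _ := GRing.Zmodule_isComRing.Build (grpalg K R)
  gamulA gamulC gamul1g gamulDl gaone_neq0.
End GrpAlg.

(* The weight lattice of a semisimple root system, given by its Cartan   *)
(* matrix, written in the basis of fundamental weights.                  *)
(* Lambda = Z^n with omega_i = i-th standard basis vector (0-indexed).   *)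

Definition lat (n : nat) := 'rV[int]_n.
Definition ZL (n : nat) := grpalg (lat n) int.

Section RootData.
Variable n : nat.
Implicit Types (C : 'M[int]_n) (l mu : lat n) (f g : ZL n).

Definition ex l : ZL n := << l >>.

(* fundamental weight omega_j (0-indexed; 0 if j >= n, never used so) *)
Definition omegan (j : nat) : lat n := \row_(k < n) ((k == j :> nat)%:R : int).

(* C is a Cartan matrix of finite type (i.e. of a reduced semisimple root
   system): C i j = <alpha_i, alpha_j^vee>, C i i = 2, C i j <= 0 for i != j,
   symmetrizable by a positive diagonal matrix with positive definite
   symmetrization. *)
Definition finite_cartan C : Prop :=
  [/\ forall i, C i i = 2,
      forall i j, i != j -> C i j <= 0 &
      exists d : 'I_n -> int,
        [/\ forall i, 0 < d i,
            forall i j, C i j * d j = C j i * d i &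
            forall x : 'I_n -> rat, (exists i, x i != 0) ->
              0 < \sum_i \sum_j x i * (C i j * d j)%:~R * x j]].

(* the simple root alpha_i in the basis of fundamental weights is row i C;
   the simple reflection s_i(l) = l - <l, alpha_i^vee> alpha_i *)
Definition refl C (i : 'I_n) l : lat n := l - (l 0 i) *: row i C.

Definition weyl_act C (w : seq 'I_n) l : lat n := foldr (refl C) l w.

Definition in_orbit C l mu : Prop := exists w, mu = weyl_act C w l.

Definition orbit C l : {fset lat n} :=
  epsilon (inhabits fset0) (fun S : {fset lat n} => forall mu, mu \in S <-> in_orbit C l mu).

Definition rho C l : ZL n := \sum_(mu <- orbit C l) ex mu.

Definition wact C (i : 'I_n) f : ZL n :=
  \sum_(mu <- msupp f) << f@_mu *g refl C i mu >>.

Definition W_invariant C f : Prop := forall i, wact C i f = f.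

Definition augm f : int := \sum_(mu <- msupp f) f@_mu.

Definition gen_ideal (S P : ZL n -> Prop) f : Prop :=
  exists m (c g : 'I_m -> ZL n),
    (forall k, S (c k) /\ P (g k)) /\ f = \sum_(k < m) c k * g k.

Definition I_sc C f : Prop :=
  gen_ideal (fun _ => True) (fun g => W_invariant C g /\ augm g = 0) f.

Definition in_ZT (T : lat n -> Prop) f : Prop := forall mu, mu \in msupp f -> T mu.

(* ---- the notation of the context (all indices 0-based) ---- *)
Definition ssz C (j : nat) : nat := #|` orbit C (omegan j)|.
Definition rhoo C (j : nat) : ZL n := rho C (omegan j).
Definition rhoj C (j : nat) : ZL n := rhoo C j - (ssz C j)%:R.
Definition dd C (n' i : nat) : nat := \big[gcdn/0%N]_(i <= j < n') ssz C j.
Definition rhot C (n' : nat) (a : nat -> nat -> int) (i : nat) : ZL n :=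
  \sum_(i <= j < n') (a i j)%:~R * rhoj C j.
Definition rhotw C n' a i : ZL n := rhot C n' a i + (dd C n' i)%:R.
Definition rr C n' (i : nat) : nat := lcmn (ssz C i) (dd C n' i.+1).
Definition h1 C n' a (l0 : lat n) (i : nat) : ZL n :=
  ex l0 * ((rr C n' i %/ ssz C i)%:R * rhoo C i
           - (rr C n' i %/ dd C n' i.+1)%:R * rhotw C n' a i.+1).
Definition h2 C n' a (i : nat) : ZL n :=
  rhoo C i * rhotw C n' a 0 - (dd C n' 0 * ssz C i)%:R.
Definition h3 C (i : nat) : ZL n := rhoj C i.

Definition gens_h C n' a l0 (g : ZL n) : Prop :=
  (exists i, (i.+1 < n')%N /\ g = h1 C n' a l0 i) \/
  (exists i, (i < n')%N /\ g = h2 C n' a i) \/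
  (exists i, (n' <= i < n)%N /\ g = h3 C i).

(* X : rows x_0, ..., x_{n-1} form a Z-basis of Lambda (X \in unitmx);
   coordinates of mu in that basis are mu *m invmx X.
   inspan X k mu  <->  mu lies in the span of x_0, ..., x_{k-1}.        *)
Definition inspan (X : 'M[int]_n) (k : nat) (mu : lat n) : Prop :=
  forall j : 'I_n, (k <= j)%N -> (mu *m invmx X) 0 j = 0.

(* writing p = sum_j p_j x_i^j, the coefficient p_j (an element of
   Z[span(x_0..x_{i-1})] when p \in Z[span(x_0..x_i)]) *)
Definition xcoef (X : 'M[int]_n) (i : 'I_n) (p : ZL n) (j : int) : ZL n :=
  \sum_(mu <- msupp p | (mu *m invmx X) 0 i == j)
     << p@_mu *g mu - j *: row i X >>.

Definition divisor (X : 'M[int]_n) (i : 'I_n) (p : ZL n) : Prop :=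
  exists k : int,
    (forall j, j < k -> xcoef X i p j = 0) /\
    exists nu, inspan X i nu /\ xcoef X i p k = ex nu.

Definition flatness (X : 'M[int]_n) (q : 'I_n -> ZL n) : Prop :=
  forall i : 'I_n,
    (forall mu, mu \in msupp (q i) -> inspan X i.+1 mu) /\ divisor X i (q i).

Definition gen_flatness (q : 'I_n -> ZL n) : Prop :=
  exists X : 'M[int]_n, X \in unitmx /\
  exists A B : 'M[ZL n]_n, [/\ A *m B = 1%:M, B *m A = 1%:M &
     flatness X (fun j => ((\row_i q i) *m A) 0 j)].

End RootData.

(* Main.v *)
(** Weyl orbits are finite because they lie on a sphere of the invariant form.
    Reflecting a weight in a simple root on which it is negative is a
    terminating rewriting system, locally confluent by inspection of the rank
    two Cartan matrices; hence an orbit has a unique dominant weight and all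
    others lie below it, [rho(omega_j)] has leading term [e^omega_j], and by
    triangularity [I_sc] is generated by [rho_0, ..., rho_{n-1}].

    Let [d = gcd(s_0, ..., s_{n'-1})].  Flatness makes
    [(q_0, ..., q_{n-1}) = (rho_0, ..., rho_{n-1}) A] a regular sequence modulo
    [d], so every syzygy of the [rho_j] modulo [d] lifts to a syzygy.  If
    [f = sum_j F_j rho_j] lies in [Z[T]], the vanishing of its odd component says
    that the parts of the [F_j] that [e^omega_j] moves to odd degree are a syzygy
    modulo [d]; subtracting a lift makes them divisible by [d].  The odd
    components of the [F_j rho_j] are then divisible by [d]: adding their
    quotients, multiplied by [rhotw 0], to the even components leaves the sum [f]
    unchanged and turns every summand into a combination of the [h]'s. *)
Require Import Defs.
From HB Require Import structures.
From mathcomp Require Import all_boot all_order all_algebra.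
From mathcomp Require Import finmap ring lra zify.
From mathcomp.multinomials Require Import monalg.
From Stdlib Require Import ClassicalEpsilon.
Set Implicit Arguments. Unset Strict Implicit. Unset Printing Implicit Defensive.
Import Order.TTheory GRing.Theory Num.Theory.
(* [all_boot] shadows [orbit] and [in_orbit]. *)
Import Defs.
Local Open Scope fset_scope.
Local Open Scope ring_scope.

(** * Subgroups and ideals *)

Section Subgroup.
Context (V : zmodType) (H : V -> Prop).
Implicit Types (x y : V).

Definition is_subgroup := H 0 /\ forall x y, H x -> H y -> H (x - y).

Hypothesis subH : is_subgroup.

Lemma subgroup0 : H 0. Proof. by case: subH. Qed.

Lemma subgroupB x y : H x -> H y -> H (x - y).
Proof. by case: subH => _; apply. Qed.

Lemma subgroupN x : H x -> H (- x).
Proof. by rewrite -sub0r; apply: subgroupB subgroup0. Qed.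

Lemma subgroupD x y : H x -> H y -> H (x + y).
Proof. by move=> Hx Hy; rewrite -[y]opprK; apply: subgroupB (subgroupN Hy). Qed.

Lemma subgroup_sum (I : Type) (r : seq I) (p : pred I) (F : I -> V) :
  (forall i, p i -> H (F i)) -> H (\sum_(i <- r | p i) F i).
Proof. by move=> HF; elim/big_ind: _ => //; [exact: subgroup0|exact: subgroupD]. Qed.

Lemma subgroupMz x (z : int) : H x -> H (x *~ z).
Proof.
move=> Hx; have Hn k : H (x *+ k).
  by elim: k => [|k IH]; rewrite ?mulrS; [exact: subgroup0|exact: subgroupD].
by case: z => k; [exact: Hn|apply/subgroupN/Hn].
Qed.

Lemma subgroup_addr x y : H y -> (H (x + y) <-> H x).
Proof.
by move=> Hy; split=> Hx; [rewrite -(addrK y x); apply: subgroupB|apply: subgroupD].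
Qed.

Lemma index2_subr x y :
  (exists z, ~ H z /\ forall t, H t \/ H (t - z)) -> ~ H x -> ~ H y -> H (x - y).
Proof.
move=> [z [_ cosets]] Hx Hy; have [//|Hxz] := cosets x; have [//|Hyz] := cosets y.
by have := subgroupB Hxz Hyz; rewrite opprB addrA subrK.
Qed.

End Subgroup.

Definition is_ideal (R : comRingType) (I : R -> Prop) :=
  is_subgroup I /\ forall c x, I x -> I (c * x).

Section SpannedIdeal.
Context (R : comRingType).
Implicit Types (u : nat -> R).

Definition ideal_of u (k : nat) (x : R) :=
  exists c : nat -> R, x = \sum_(i < k) c i * u i.

Lemma ideal_of_is_ideal u k : is_ideal (ideal_of u k).
Proof.
split=> [|c _ [e ->]]; last first.
  by exists (fun i => c * e i); rewrite mulr_sumr; apply: eq_bigr => i _; rewrite mulrA.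
split=> [|_ _ [e ->] [e' ->]].
  by exists (fun=> 0); rewrite big1 // => i _; rewrite mul0r.
by exists (fun i => e i - e' i); rewrite -sumrB; apply: eq_bigr => i _; rewrite mulrBl.
Qed.

Lemma ideal_of_gen u k i : (i < k)%N -> ideal_of u k (u i).
Proof.
move=> lt_ik; exists (fun j => (j == i)%:R).
rewrite (bigD1 (Ordinal lt_ik)) //= eqxx mul1r big1 ?addr0 // => j.
by rewrite -val_eqE /= => /negPf ->; rewrite mul0r.
Qed.

End SpannedIdeal.

Section GeneratedIdeal.
Variable n : nat.
Implicit Types (f g : ZL n) (S P : ZL n -> Prop).

Lemma gen_ideal0 S P : gen_ideal S P 0.
Proof. by exists 0%N, (fun=> 0), (fun=> 0); split; [case|rewrite big_ord0]. Qed.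

Lemma gen_ideal_mul S P c g : S c -> P g -> gen_ideal S P (c * g).
Proof. by move=> Sc Pg; exists 1%N, (fun=> c), (fun=> g); rewrite big_ord1. Qed.

Lemma gen_idealD S P f g : gen_ideal S P f -> gen_ideal S P g -> gen_ideal S P (f + g).
Proof.
move=> [m [c [u [Scu ->]]]] [m' [c' [u' [Scu' ->]]]].
exists (m + m')%N.
exists (fun i => match split i with inl j => c j | inr j => c' j end).
exists (fun i => match split i with inl j => u j | inr j => u' j end).
split=> [k|]; first by case: split => j; [apply: Scu|apply: Scu'].
rewrite big_split_ord /=; congr (_ + _); apply: eq_bigr => i _.
  by rewrite -[lshift _ _]/(unsplit (inl i)) unsplitK.
by rewrite -[rshift _ _]/(unsplit (inr i)) unsplitK.
Qed.

Lemma gen_ideal_sum S P (I : Type) (r : seq I) (F : I -> ZL n) :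
  (forall i, gen_ideal S P (F i)) -> gen_ideal S P (\sum_(i <- r) F i).
Proof. by move=> PF; elim/big_ind: _ => //; [exact: gen_ideal0|exact: gen_idealD]. Qed.

Lemma gen_ideal_is_ideal P : is_ideal (gen_ideal (fun=> True) P).
Proof.
have PMl c f : gen_ideal (fun=> True) P f -> gen_ideal (fun=> True) P (c * f).
  move=> [m [d [u [Pu ->]]]]; rewrite mulr_sumr; apply: gen_ideal_sum => i.
  by rewrite mulrA; apply: gen_ideal_mul => //; case: (Pu i).
split=> //; split=> [|f g Pf Pg]; first exact: gen_ideal0.
by rewrite -mulN1r; apply: gen_idealD Pf (PMl _ _ Pg).
Qed.

Lemma gen_ideal_gen P f : P f -> gen_ideal (fun=> True) P f.
Proof. by move=> Pf; rewrite -[f]mul1r; apply: gen_ideal_mul. Qed.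

Lemma gen_ideal_sub P (I : ZL n -> Prop) S f :
  is_ideal I -> (forall g, P g -> I g) -> gen_ideal S P f -> I f.
Proof.
move=> [subI IMl] PI [m [c [g [Pg ->]]]]; apply: subgroup_sum => // k _.
by apply/IMl/PI; case: (Pg k).
Qed.

End GeneratedIdeal.

(** * Syzygies modulo an element *)

Section Syzygies.
Context (R : comRingType) (d : R).
Implicit Types (q : nat -> R).

Definition prepend q (i : nat) : R := if i is j.+1 then q j else d.

Definition regular_mod q k := forall i, (i < k)%N -> forall x,
  ideal_of (prepend q) i.+1 (x * q i) -> ideal_of (prepend q) i.+1 x.

Lemma ideal_of_prepend q k x :
  ideal_of (prepend q) k.+1 x <->
  exists (c : nat -> R) w, x = \sum_(i < k) c i * q i + d * w.
Proof.
split=> [[c ->]|[c [w ->]]].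
  by exists (c \o succn), (c 0%N); rewrite big_ord_recl /= addrC mulrC.
exists (fun i => if i is j.+1 then c j else w).
by rewrite big_ord_recl /= addrC mulrC.
Qed.

Lemma syzygy_lift q k : regular_mod q k ->
  forall (g : nat -> R) w, \sum_(i < k) g i * q i = d * w ->
  exists u v : nat -> R, \sum_(i < k) u i * q i = 0 /\
    forall i, (i < k)%N -> g i = u i + d * v i.
Proof.
elim: k => [|k IH] reg g w.
  by exists (fun=> 0), (fun=> 0); rewrite big_ord0.
rewrite big_ord_recr /= => syz.
have [|c [w' gk]] := (ideal_of_prepend q k (g k)).1.
  apply: reg => //; apply/ideal_of_prepend; exists (fun i => - g i), w.
  by rewrite -syz addrA -big_split big1 ?add0r //= => i _; rewrite mulNr addNr.
have [|u [v [u0 guv]]] := IH (fun i ik => reg i (ltnW ik))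
                             (fun i => g i + c i * q k) (w - w' * q k).
  under eq_bigr do rewrite mulrDl mulrAC.
  by rewrite big_split -mulr_suml mulrBr /= -syz gk; ring.
pose sum_c := \sum_(i < k) c i * q i.
exists (fun i => if (i < k)%N then u i - c i * q k else sum_c).
exists (fun i => if (i < k)%N then v i else w'); split=> [|i].
  rewrite big_ord_recr /= ltnn.
  under eq_bigr do rewrite ltn_ord mulrBl mulrAC.
  by rewrite sumrB u0 -mulr_suml sub0r addNr.
rewrite ltnS leq_eqVlt => /predU1P[-> | lt_ik]; first by rewrite ltnn.
by rewrite lt_ik addrAC -guv // addrK.
Qed.

End Syzygies.

Lemma syzygy_lift_mx (R : comRingType) (d : R) n (q : 'rV[R]_n) (g : 'cV[R]_n) w :
  regular_mod d (fun i => oapp (q 0) 0 (insub i)) n -> q *m g = (d * w)%:M ->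
  exists u v : 'cV[R]_n, q *m u = 0 /\ g = u + d *: v.
Proof.
move=> reg /matrixP/(_ 0 0); rewrite !mxE eqxx mulr1n => syz.
have [|u [v [u0 guv]]] :=
  syzygy_lift reg (g := fun i => oapp (g^~ 0) 0 (insub i)) (w := w).
  by rewrite -syz; apply: eq_bigr => i _ /=; rewrite !valK /= mulrC.
exists (\col_i u i), (\col_i v i); split; last first.
  by apply/colP => i; rewrite !mxE -guv //= valK.
apply/matrixP => i j; rewrite !ord1 !mxE -[RHS]u0; apply: eq_bigr => k _.
by rewrite !mxE valK /= mulrC.
Qed.

(** * Integer relations *)

Lemma dvd_lcm_quotients (b d : nat) (c : int) : (0 < b)%N -> (d %| c * b)%Z ->
  exists z : int,
    c = z * (lcmn b d %/ b)%N%:Z /\ c * b = z * (lcmn b d %/ d)%N%:Z * d%:Z.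
Proof.
move=> b_gt0 d_cb.
have /dvdzP[z Ez] : (lcmn b d %| c * b)%Z.
  by move: d_cb; rewrite !dvdzE abszM dvdn_lcm => ->; rewrite dvdn_mull.
exists z; rewrite -!mulrA -PoszM divnK ?dvdn_lcmr //; split=> //.
have b_neq0 : b%:Z != 0 by rewrite eqz_nat -lt0n.
by apply: (mulIf b_neq0); rewrite -mulrA -PoszM divnK ?dvdn_lcml.
Qed.

Section IntegerRelations.
Context (s : nat -> nat) (m : nat) (a : nat -> nat -> int).

Definition tail_gcd i := \big[gcdn/0%N]_(i <= j < m) s j.

Hypothesis s_gt0 : forall j, (0 < s j)%N.
Hypothesis bezout : forall i, (i < m)%N ->
  (tail_gcd i)%:Z = \sum_(i <= j < m) a i j * (s j)%:Z.

Lemma tail_gcd_dvd i k : (i <= k < m)%N -> (tail_gcd i %| s k)%N.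
Proof.
by move=> ik; rewrite /tail_gcd (bigD1_seq k) ?mem_index_iota ?iota_uniq //= dvdn_gcdl.
Qed.

Lemma tail_gcd_gt0 i : (i < m)%N -> (0 < tail_gcd i)%N.
Proof. by move=> lt_im; apply: dvdn_gt0 (s_gt0 i) _; rewrite tail_gcd_dvd ?leqnn. Qed.

Context (V : zmodType) (x : nat -> V) (H : V -> Prop).
Hypothesis subH : is_subgroup H.

Definition bezout_comb i := \sum_(i <= j < m) x j *~ a i j.

Hypothesis H_elim : forall i, (i.+1 < m)%N ->
  let r := lcmn (s i) (tail_gcd i.+1) in
  H (x i *+ (r %/ s i) - bezout_comb i.+1 *+ (r %/ tail_gcd i.+1)).

(* Elimination of the first coefficient, which is a multiple of [r / s i]
   because [tail_gcd i.+1] divides the other terms of the relation. *)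
Lemma relation_in_subgroup i (c : nat -> int) : (i <= m)%N ->
  \sum_(i <= k < m) c k * (s k)%:Z = 0 -> H (\sum_(i <= k < m) x k *~ c k).
Proof.
elim: {i}(m - i)%N {-2}i (erefl (m - i)%N) c => [|e IH] i Ee c le_im.
  by rewrite !big_geq; [move=> _; apply: subgroup0|lia..].
have lt_im : (i < m)%N by lia.
rewrite !(big_ltn lt_im) => rel.
have [lt1|ge1] := ltnP i.+1 m; last first.
  move: rel; rewrite !big_geq // !addr0 => /eqP.
  by rewrite mulf_eq0 eqz_nat (gtn_eqF (s_gt0 i)) orbF => /eqP ->; apply: subgroup0.
have [|z [Ec Ecs]] := @dvd_lcm_quotients (s i) (tail_gcd i.+1) (c i) (s_gt0 i).
  rewrite -[c i * _]opprK (addr0_eq rel) rpredN big_nat; apply: rpred_sum => k ik.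
  by rewrite dvdz_mull // dvdzE tail_gcd_dvd.
move: Ec Ecs (H_elim lt1) => /=; set t := (_ %/ s i)%N; set t' := (_ %/ tail_gcd _)%N.
move=> Ec Ecs Hi.
pose c' k := c k + a i.+1 k * (z * t').
have -> : x i *~ c i + \sum_(i.+1 <= k < m) x k *~ c k =
    (x i *+ t - bezout_comb i.+1 *+ t') *~ z + \sum_(i.+1 <= k < m) x k *~ c' k.
  under [in RHS]eq_bigr do rewrite mulrzDr mulrzA.
  rewrite big_split /= -mulrz_suml -/(bezout_comb _) mulrzBl !pmulrn -!mulrzA Ec.
  by rewrite ![t%:Z * z]mulrC [t'%:Z * z]mulrC addrACA addNr addr0.
apply: subgroupD => //; first exact: subgroupMz.
apply: IH => //; first by lia.
under eq_bigr do rewrite mulrDl mulrAC.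
by rewrite big_split -mulr_suml /= -(bezout lt1) [_ * (z * t')]mulrC -Ecs addrC.
Qed.

Lemma sub_bezout_comb_in_subgroup i j : (i <= j < m)%N ->
  H (x j - bezout_comb i *+ (s j %/ tail_gcd i)).
Proof.
move=> ij; set t := (_ %/ _)%N; have lt_im : (i < m)%N by lia.
have sum_delta (W : zmodType) (F : nat -> W) :
    \sum_(i <= k < m) F k *+ (k == j) = F j.
  rewrite (bigD1_seq j) ?mem_index_iota ?iota_uniq //= eqxx mulr1n.
  by rewrite big1 ?addr0 // => k /negPf ->.
have -> : x j - bezout_comb i *+ t =
    \sum_(i <= k < m) x k *~ ((k == j)%:Z - a i k * t).
  under eq_bigr do rewrite mulrzBr mulrzA.
  by rewrite sumrB sum_delta -mulrz_suml.
apply: relation_in_subgroup; first exact: ltnW.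
under eq_bigr do rewrite mulrBl mulrAC -natz mulr_natl.
by rewrite sumrB sum_delta -mulr_suml -bezout // -PoszM mulnC divnK ?tail_gcd_dvd ?subrr.
Qed.

End IntegerRelations.

(** * Group algebras *)

Definition classicb (P : Prop) : bool :=
  if excluded_middle_informative P then true else false.

Lemma classicbP (P : Prop) : reflect P (classicb P).
Proof. by rewrite /classicb; case: excluded_middle_informative => ?; constructor. Qed.

Section GroupAlgebra.
Context (K : zmodType) (R : comRingType).
Implicit Types (f g : grpalg K R) (Q : K -> Prop).

Lemma grpalgUM (c1 c2 : R) (k1 k2 : K) :
  (<< c1 *g k1 >> : grpalg K R) * << c2 *g k2 >> = << c1 * c2 *g k1 + k2 >>.
Proof. exact: gamulUU. Qed.

Lemma grpalg_ind (P : grpalg K R -> Prop) :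
  P 0 -> (forall c k g, P g -> P (<< c *g k >> + g)) -> forall f, P f.
Proof.
move=> P0 PD f; rewrite (monalgE f).
by elim: (enum_fset (msupp f)) => [|k s IH]; rewrite ?big_nil // big_cons; apply: PD.
Qed.

Lemma grpalg_morphM (S : comRingType) (F : grpalg K R -> S) :
  zmod_morphism F ->
  (forall c k c' k', F ((<< c *g k >> : grpalg K R) * << c' *g k' >>) =
                     F << c *g k >> * F << c' *g k' >>) ->
  {morph F : f g / f * g}.
Proof.
move=> FB FM; have F0 : F 0 = 0 by rewrite -[X in F X](subrr 0) FB subrr.
have FD : {morph F : f g / f + g}.
  by move=> f g; rewrite -[g in LHS]opprK -[- g]sub0r !FB F0 sub0r opprK.
move=> f g; elim/grpalg_ind: f => [|c k f IH]; first by rewrite mul0r F0 mul0r.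
rewrite mulrDl !FD IH mulrDl; congr (_ + _).
elim/grpalg_ind: g {IH f} => [|c' k' g IH]; first by rewrite mulr0 F0 mulr0.
by rewrite mulrDr !FD IH FM mulrDr.
Qed.

Definition supp_in Q f := forall k, f@_k != 0 -> Q k.

Lemma supp_inU Q c k : Q k -> supp_in Q << c *g k >>.
Proof.
move=> Qk k'; rewrite mcoeffU; case: (k =P k') => [<- //|_].
by rewrite mulr0n eqxx.
Qed.

Lemma supp_in_subgroup Q : is_subgroup (supp_in Q).
Proof.
split=> [k|f g Qf Qg k]; first by rewrite mcoeff0 eqxx.
rewrite mcoeffB; case: (f@_k =P 0) => [->|/eqP/Qf //].
by rewrite sub0r oppr_eq0 => /Qg.
Qed.

Lemma supp_in_int Q (z : int) : Q 0 -> supp_in Q (z%:~R : grpalg K R).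
Proof. by move=> Q0; apply: (subgroupMz (supp_in_subgroup Q)); apply: supp_inU. Qed.

Lemma supp_in_nat Q (m : nat) : Q 0 -> supp_in Q (m%:R : grpalg K R).
Proof. by rewrite pmulrn; apply: supp_in_int. Qed.

Lemma supp_inM (Q1 Q2 Q : K -> Prop) f g :
  (forall k1 k2, Q1 k1 -> Q2 k2 -> Q (k1 + k2)) ->
  supp_in Q1 f -> supp_in Q2 g -> supp_in Q (f * g).
Proof.
move=> QD Qf Qg; rewrite [f * g]gamulE.
rewrite big_seq; apply: (subgroup_sum (supp_in_subgroup Q)) => k1 k1f.
rewrite big_seq; apply: (subgroup_sum (supp_in_subgroup Q)) => k2 k2g.
by apply: supp_inU; apply: QD; [apply: Qf|apply: Qg]; rewrite mcoeff_neq0.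
Qed.

Lemma supp_inW (Q1 Q2 : K -> Prop) f :
  (forall k, Q1 k -> Q2 k) -> supp_in Q1 f -> supp_in Q2 f.
Proof. by move=> QW Qf k /Qf /QW. Qed.

Definition restr Q f : grpalg K R :=
  [malg k in msupp f => if classicb (Q k) then f@_k else 0].

Lemma mcoeff_restr Q f k : (restr Q f)@_k = if classicb (Q k) then f@_k else 0.
Proof. by rewrite mcoeffE; case: msuppP => //; case: ifP. Qed.

Lemma restrE Q f : restr Q f = \sum_(k <- msupp f | classicb (Q k)) << f@_k *g k >>.
Proof.
rewrite [LHS](@monalgEw _ _ _ (msupp f)); last first.
  apply/fsubsetP => k; rewrite -!mcoeff_neq0 mcoeff_restr.
  by case: ifP => //; rewrite eqxx.
rewrite [RHS]big_mkcond; apply: eq_bigr => k _.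
by rewrite mcoeff_restr; case: ifP => // _; rewrite monalgU0.
Qed.

Fact restr_is_additive Q : zmod_morphism (restr Q).
Proof.
move=> f g; apply/malgP => k; rewrite mcoeffB !mcoeff_restr mcoeffB.
by case: ifP; rewrite ?subr0.
Qed.
HB.instance Definition _ Q :=
  GRing.isZmodMorphism.Build (grpalg K R) (grpalg K R) (restr Q) (restr_is_additive Q).

Lemma eq_restr Q Q' f : (forall k, Q k <-> Q' k) -> restr Q f = restr Q' f.
Proof.
move=> QQ'; apply/malgP => k; rewrite !mcoeff_restr.
by congr (if _ then _ else _); apply/classicbP/classicbP => /QQ'.
Qed.

Lemma supp_restr Q f : supp_in Q (restr Q f).
Proof. by move=> k; rewrite mcoeff_restr; case: classicbP; rewrite ?eqxx. Qed.

Lemma supp_sub_restr Q f : supp_in (fun k => f@_k != 0 /\ ~ Q k) (f - restr Q f).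
Proof.
by move=> k; rewrite mcoeffB mcoeff_restr; case: classicbP; rewrite ?subrr ?eqxx ?subr0.
Qed.

Lemma restr_unique Q f g :
  supp_in Q g -> supp_in (fun k => ~ Q k) (f - g) -> restr Q f = g.
Proof.
move=> Qg Qfg; apply/malgP => k; rewrite mcoeff_restr; case: classicbP => Qk.
  apply/eqP; rewrite -subr_eq0 -mcoeffB; apply/negPn/negP => /Qfg; exact.
by apply/esym/eqP/negPn/negP => /Qg.
Qed.

Lemma restr_id Q f : supp_in Q f -> restr Q f = f.
Proof.
move=> Qf; apply: restr_unique => //; rewrite subrr.
exact: subgroup0 (supp_in_subgroup _).
Qed.

Lemma restr_eq0 Q f : supp_in (fun k => ~ Q k) f -> restr Q f = 0.
Proof.
move=> Qf; apply: restr_unique; last by rewrite subr0.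
exact: subgroup0 (supp_in_subgroup Q).
Qed.

Lemma restrM Q Q' f g :
  supp_in (fun k => forall l, Q (l + k) <-> Q' l) g -> restr Q (f * g) = restr Q' f * g.
Proof.
move=> Qg; apply: restr_unique.
  by apply: supp_inM (@supp_restr Q' f) Qg => k1 k2 Q'k1 ->.
by rewrite -mulrBl; apply: supp_inM (@supp_sub_restr Q' f) Qg => k1 k2 [_ Q'k1] ->.
Qed.

Lemma ideal_of_restr Q u k f :
  (forall i, (i < k)%N -> supp_in (fun l => forall l', Q (l' + l) <-> Q l') (u i)) ->
  ideal_of u k f -> ideal_of u k (restr Q f).
Proof.
move=> Qu [c ->]; exists (fun i => restr Q (c i)).
by rewrite raddf_sum; apply: eq_bigr => i _ /=; apply/restrM/Qu.
Qed.

End GroupAlgebra.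

Arguments supp_in_subgroup {K R} Q.

Section LowestDegree.
Context (K : zmodType) (R : comRingType) (chi : {additive K -> int}).
Implicit Types (f g p : grpalg K R).

Lemma restr_lowestM m m' f g :
  supp_in (fun k => m <= chi k) f -> supp_in (fun k => m' <= chi k) g ->
  restr (fun k => chi k = m + m') (f * g) =
  restr (fun k => chi k = m) f * restr (fun k => chi k = m') g.
Proof.
move=> low_f low_g; pose f0 := restr (fun k => chi k = m) f.
pose g0 := restr (fun k => chi k = m') g; apply: restr_unique.
  apply: supp_inM (@supp_restr _ _ _ f) (@supp_restr _ _ _ g) => k l.
  by rewrite raddfD => -> ->.
have -> : f * g - f0 * g0 = (f - f0) * g + f0 * (g - g0) by ring.
apply: (subgroupD (supp_in_subgroup _)).
  apply: supp_inM (@supp_sub_restr _ _ _ f) low_g => k l [/low_f + ne] le.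
  by rewrite raddfD /=; lia.
apply: supp_inM (@supp_restr _ _ _ f) (@supp_sub_restr _ _ _ g) => k l eq [/low_g + ne].
by rewrite raddfD /=; lia.
Qed.

Lemma supp_in_bounded f :
  exists m (e : nat), supp_in (fun k => m <= chi k < m + e%:Z) f.
Proof.
pose b := (\sum_(k <- msupp f) `|chi k|%N)%N.
exists (- b%:Z), (2 * b + 1)%N => k; rewrite mcoeff_neq0 => kf.
have : (`|chi k| <= b)%N by rewrite /b (big_fsetD1 k kf) leq_addr.
lia.
Qed.

(* The ideal is graded by [chi] and the lowest component of [p] is a unit, so
   the lowest component of [f] can be split off. *)
Lemma ideal_of_cancel u i f p m nu :
  (forall j, (j < i)%N -> supp_in (fun k => chi k = 0) (u j)) ->
  supp_in (fun k => m <= chi k) p ->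
  restr (fun k => chi k = m) p = << nu >> ->
  ideal_of u i (f * p) -> ideal_of u i f.
Proof.
move=> u0 low_p lead_p; have [subI IMl] := ideal_of_is_ideal u i.
have [m' [e]] := supp_in_bounded f.
elim: e m' f => [|e IH] m' f supp_f fp.
  suff -> : f = 0 by apply: subgroup0 subI.
  apply/malgP => k; rewrite mcoeff0; apply/eqP/negPn/negP => /supp_f; lia.
pose f0 := restr (fun k => chi k = m') f.
have If0 : ideal_of u i f0.
  have : ideal_of u i (restr (fun k => chi k = m' + m) (f * p)).
    apply: ideal_of_restr => // j /u0; apply: supp_inW => k k0 l.
    by rewrite raddfD /= k0 addr0.
  rewrite restr_lowestM // => [|k /supp_f]; last by lia.
  move/(IMl << - nu >>); rewrite lead_p mulrCA grpalgUM addNr mulr1.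
  by rewrite -[<< 0 >>]/(1 : grpalg K R) mulr1.
rewrite -(subrK f0 f); apply: (subgroupD subI) => //; apply: (IH (m' + 1)).
  by move=> k /supp_sub_restr[/supp_f]; lia.
by rewrite mulrBl; apply: (subgroupB subI) => //; rewrite mulrC; apply: IMl.
Qed.

End LowestDegree.

Section CosetGrading.
Context (K : zmodType) (R : comRingType) (T : K -> Prop).
Implicit Types (f g : grpalg K R) (k l : K).

Definition homogeneous l f := supp_in (fun k => T (k - l)) f.
Definition component l f : grpalg K R := restr (fun k => T (k - l)) f.

HB.instance Definition _ l := GRing.isZmodMorphism.Build (grpalg K R) (grpalg K R)
  (component l) (restr_is_additive _).

Hypothesis subT : is_subgroup T.

Lemma homogeneous_subgroup l : is_subgroup (homogeneous l).
Proof. exact: supp_in_subgroup. Qed.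

Lemma homogeneousU c k : homogeneous k << c *g k >>.
Proof. by apply: supp_inU; rewrite subrr; apply: subgroup0 subT. Qed.

Lemma homogeneous_int (z : int) : homogeneous 0 (z%:~R : grpalg K R).
Proof. by apply: supp_in_int; rewrite subr0; apply: subgroup0 subT. Qed.

Lemma homogeneous_nat (m : nat) : homogeneous 0 (m%:R : grpalg K R).
Proof. by rewrite pmulrn; apply: homogeneous_int. Qed.

Lemma homogeneousM l l' f g :
  homogeneous l f -> homogeneous l' g -> homogeneous (l + l') (f * g).
Proof.
by apply: supp_inM => k k' Tk Tk'; rewrite opprD addrACA; apply: (subgroupD subT).
Qed.

Lemma subgroup_congr l l' k : T (l - l') -> (T (k - l) <-> T (k - l')).
Proof.
move=> Tll'; have -> : k - l' = k - l + (l - l') by rewrite addrA subrK.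
by apply: iff_sym; apply: subgroup_addr.
Qed.

Lemma homogeneous_congr l l' f : T (l - l') -> homogeneous l f -> homogeneous l' f.
Proof. by move=> Tll'; apply: supp_inW => k /(subgroup_congr k Tll'). Qed.

Lemma component_congr l l' f : T (l - l') -> component l f = component l' f.
Proof. by move=> Tll'; apply: eq_restr => k; apply: subgroup_congr. Qed.

Lemma homogeneous_component l f : homogeneous l (component l f).
Proof. exact: supp_restr. Qed.

Lemma component_id l f : homogeneous l f -> component l f = f.
Proof. exact: restr_id. Qed.

Lemma component_eq0 l l' f : ~ T (l - l') -> homogeneous l f -> component l' f = 0.
Proof.
move=> nT homf; apply: restr_eq0; apply: supp_inW homf => k Tk Tk'; apply: nT.
have -> : l - l' = (k - l') - (k - l) by rewrite opprB [RHS]addrC addrA subrK.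
exact: subgroupB.
Qed.

Lemma componentM l l' f g :
  homogeneous l' g -> component l (f * g) = component (l - l') f * g.
Proof.
move=> homg; apply: restrM; apply: supp_inW homg => k Tk k'.
have -> : k' + k - l = k' - (l - l') + (k - l').
  by rewrite opprB addrACA [l' - l - l']addrAC subrr sub0r.
exact: subgroup_addr.
Qed.

Lemma component_natM l (m : nat) f : component l (m%:R * f) = m%:R * component l f.
Proof. by rewrite !mulr_natl raddfMn. Qed.

End CosetGrading.

Arguments homogeneous_subgroup {K R} T l.

Section WeightAlgebra.
Variable n : nat.
Implicit Types (f g : ZL n).

Lemma exM (l m : lat n) : ex l * ex m = ex (l + m).
Proof. by rewrite /ex grpalgUM mulr1. Qed.

Lemma ex0 : ex (0 : lat n) = 1. Proof. by []. Qed.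

Lemma exNK (l : lat n) f : ex (- l) * (ex l * f) = f.
Proof. by rewrite mulrA exM addNr ex0 mul1r. Qed.

Lemma augmE f : augm f = mmap idfun (fun=> 1) f.
Proof. by rewrite mmapE; apply: eq_bigr => k _; rewrite mulr1. Qed.

Lemma augmU c (k : lat n) : augm << c *g k >> = c.
Proof. by rewrite augmE mmapU mulr1. Qed.

Fact augm_is_additive : zmod_morphism (@augm n).
Proof. by move=> f g; rewrite !augmE mmapB. Qed.
HB.instance Definition _ :=
  GRing.isZmodMorphism.Build (ZL n) int (@augm n) augm_is_additive.

Fact augm_is_multiplicative : monoid_morphism (@augm n).
Proof.
split; first exact: augmU.
apply: (grpalg_morphM augm_is_additive) => c k c' k'; rewrite grpalgUM.
exact: etrans (augmU _ _) (esym (congr2 *%R (augmU c k) (augmU c' k'))).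
Qed.
HB.instance Definition _ :=
  GRing.isMonoidMorphism.Build (ZL n) int (@augm n) augm_is_multiplicative.

Lemma in_ZTE (T : lat n -> Prop) f : in_ZT T f <-> homogeneous T 0 f.
Proof. by split=> Tf k; have := Tf k; rewrite mcoeff_neq0 subr0. Qed.

Lemma gen_ideal_in_ZT (T : lat n -> Prop) (P : ZL n -> Prop) f :
  is_subgroup T -> (forall g, P g -> homogeneous T 0 g) ->
  in_ZT T f /\ gen_ideal (fun=> True) P f <-> gen_ideal (in_ZT T) P f.
Proof.
move=> subT homP; split=> [[/in_ZTE homf]|] [m [c [g [TPcg Ef]]]].
  rewrite -(component_id homf) Ef raddf_sum; apply: gen_ideal_sum => k /=.
  have [_ Pgk] := TPcg k; rewrite (componentM subT _ _ (homP _ Pgk)) subr0.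
  apply: gen_ideal_mul => //; apply/in_ZTE; exact: homogeneous_component.
rewrite Ef; split; last first.
  by apply: gen_ideal_sum => k; apply: gen_ideal_mul; case: (TPcg k).
apply/in_ZTE; apply: (subgroup_sum (homogeneous_subgroup T 0)) => k _.
have [/in_ZTE homc Pgk] := TPcg k.
by rewrite -[0 : lat n]addr0; apply: (homogeneousM subT) homc (homP _ Pgk).
Qed.

Lemma natM_eq0 (m : nat) f : (0 < m)%N -> m%:R * f = 0 -> f = 0.
Proof.
move=> m_gt0 mf; apply/malgP => mu; have /malgP/(_ mu) := mf.
rewrite mulr_natl mcoeffMn mcoeff0 => /eqP.
by rewrite mulrn_eq0 (gtn_eqF m_gt0) => /eqP.
Qed.

End WeightAlgebra.

(** * Flatness *)

Section Flatness.
Context (n d : nat).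

Definition coord (X : 'M[int]_n) (i : 'I_n) (mu : lat n) : int := (mu *m invmx X) 0 i.

Fact coord_is_additive X i : zmod_morphism (coord X i).
Proof. by move=> mu nu; rewrite /coord mulmxBl !mxE. Qed.
HB.instance Definition _ X i :=
  GRing.isZmodMorphism.Build (lat n) int (coord X i) (coord_is_additive X i).

Lemma restr_coord X (i : 'I_n) p (j : int) :
  restr (fun mu => coord X i mu = j) p = ex (j *: row i X) * xcoef X i p j.
Proof.
rewrite restrE /xcoef mulr_sumr; apply: eq_big => [mu|mu _].
  exact/classicbP/eqP.
by rewrite grpalgUM mul1r addrC subrK.
Qed.

Lemma flatness_regular_mod X (q : nat -> ZL n) :
  flatness X (fun i : 'I_n => q i) -> regular_mod d%:R q n.
Proof.
move=> flat i lt_in x; set o := Ordinal lt_in.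
have [_ [k [low [nu [_ lead]]]]] := flat o.
apply: (@ideal_of_cancel _ _ (coord X o) _ _ _ _ k (k *: row o X + nu)).
- case=> [|j] lt_ji; first by apply: supp_in_nat; rewrite raddf0.
  move=> mu; rewrite mcoeff_neq0 => mu_supp.
  have [/(_ mu mu_supp) span _] := flat (Ordinal (ltn_trans (lt_ji : (j < i)%N) lt_in)).
  exact: (span o).
- move=> mu mu_supp; rewrite leNgt; apply/negP => /low xcoef0.
  have := restr_coord X o (q i) (coord X o mu).
  rewrite xcoef0 mulr0 => /malgP/(_ mu); rewrite mcoeff_restr mcoeff0.
  by case: classicbP => // _ mu0; rewrite mu0 eqxx in mu_supp.
- by rewrite restr_coord lead exM.
Qed.

Lemma gen_flatness_syzygy_lift (q : 'I_n -> ZL n) (g : 'cV[ZL n]_n) w :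
  gen_flatness q -> (\row_i q i) *m g = (d%:R * w)%:M ->
  exists u v : 'cV[ZL n]_n, (\row_i q i) *m u = 0 /\ g = u + d%:R *: v.
Proof.
move=> [X [_ [A [B [AB BA flat]]]]] syz; pose r := (\row_i q i) *m A.
have [||u [v [u0 Bg]]] := @syzygy_lift_mx _ d%:R _ r (B *m g) w.
- apply: (@flatness_regular_mod X) => i; rewrite valK; exact: flat.
- by rewrite mulmxA -[r *m B]mulmxA AB mulmx1.
exists (A *m u), (A *m v); split; first by rewrite mulmxA.
by rewrite scalemxAr -mulmxDr -Bg mulmxA AB mul1mx.
Qed.

End Flatness.

(** * The invariant form of a Cartan matrix *)

Section WeightOrder.
Context (n : nat) (C : 'M[int]_n).
Implicit Types (l mu nu lam : lat n) (z : 'rV[int]_n).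

Definition nonneg_row z := forall i, 0 <= z 0 i.

Definition dominant l := nonneg_row l.

Definition below nu lam :=
  exists z, [/\ nonneg_row z, z != 0 & lam = nu + z *m C].

Lemma nonneg_rowD z z' :
  nonneg_row z -> nonneg_row z' -> nonneg_row (z + z').
Proof. by move=> z0 z0' i; rewrite mxE addr_ge0. Qed.

Lemma nonneg_rowD_neq0 z z' :
  nonneg_row z -> nonneg_row z' -> z != 0 -> z + z' != 0.
Proof.
move=> z0 z0'; apply: contra_neq => /rowP E; apply/rowP => i.
by move/eqP: (E i); rewrite !mxE paddr_eq0 // => /andP[/eqP].
Qed.

Lemma belowD nu lam nu' lam' :
  below nu lam -> below nu' lam' -> below (nu + nu') (lam + lam').
Proof.
move=> [z [z0 zn ->]] [z' [z0' _ ->]]; exists (z + z'); split.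
- exact: nonneg_rowD.
- exact: nonneg_rowD_neq0.
- by rewrite mulmxDl addrACA.
Qed.

Lemma below_addl mu nu lam : below nu lam -> below (mu + nu) (mu + lam).
Proof. by move=> [z [z0 zn ->]]; exists z; rewrite addrA. Qed.

Lemma below_trans mu nu lam : below mu nu -> below nu lam -> below mu lam.
Proof.
move=> [z [z0 zn ->]] [z' [z0' _ ->]]; exists (z + z'); split.
- exact: nonneg_rowD.
- exact: nonneg_rowD_neq0.
- by rewrite mulmxDl addrA.
Qed.

Lemma below_refl i l : l 0 i < 0 -> below l (refl C i l).
Proof.
move=> li; exists (- l 0 i *: delta_mx 0 i); split.
- by move=> j; rewrite !mxE mulr_ge0 ?ler0n // oppr_ge0 ltW.
- apply: contraTneq li => /rowP/(_ i)/eqP.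
  by rewrite !mxE !eqxx mulr1 oppr_eq0 => /eqP ->; rewrite ltxx.
- by rewrite -scalemxAl -rowE scaleNr.
Qed.

End WeightOrder.

Section InvariantForm.
Context (n : nat) (C : 'M[int]_n) (d : 'I_n -> int).
Hypothesis Cii : forall i, C i i = 2.
Hypothesis d_gt0 : forall i, 0 < d i.
Hypothesis Cd_sym : forall i j, C i j * d j = C j i * d i.
Hypothesis Cd_posdef : forall x : 'I_n -> rat, (exists i, x i != 0) ->
  0 < \sum_i \sum_j x i * (C i j * d j)%:~R * x j.
Implicit Types (l mu nu lam : lat n) (x y : 'rV[rat]_n) (i j : 'I_n).

Let CQ : 'M[rat]_n := map_mx intr C.
Let CdQ : 'M[rat]_n := \matrix_(i, j) (C i j * d j)%:~R.

Definition bform x y : rat := (x *m CdQ *m y^T) 0 0.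

Lemma bform_sym x y : bform x y = bform y x.
Proof.
rewrite /bform -[in RHS](trmxK (y *m CdQ *m x^T)) [RHS]mxE !trmx_mul trmxK mulmxA.
by congr ((_ *m _ *m _) _ _); apply/matrixP => i j; rewrite !mxE Cd_sym.
Qed.

Lemma bformDl x y z : bform (x + y) z = bform x z + bform y z.
Proof. by rewrite /bform !mulmxDl mxE. Qed.

Lemma bformZl c x y : bform (c *: x) y = c * bform x y.
Proof. by rewrite /bform -!scalemxAl mxE. Qed.

Lemma bformDr x y z : bform x (y + z) = bform x y + bform x z.
Proof. by rewrite bform_sym bformDl !(bform_sym _ x). Qed.

Lemma bformZr c x y : bform x (c *: y) = c * bform x y.
Proof. by rewrite bform_sym bformZl bform_sym. Qed.

Lemma bform_gt0 x : x != 0 -> 0 < bform x x.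
Proof.
move=> x0.
have -> : bform x x = \sum_i \sum_j x 0 i * (C i j * d j)%:~R * x 0 j.
  rewrite /bform mxE exchange_big /=; apply: eq_bigr => j _; rewrite !mxE mulr_suml.
  by apply: eq_bigr => k _; rewrite !mxE.
apply: Cd_posdef; apply/existsP; apply: contraNT x0 => /existsPn x_eq0.
by apply/eqP/rowP => i; rewrite mxE; apply/eqP; move: (x_eq0 i); rewrite negbK.
Qed.

Lemma bform_ge0 x : 0 <= bform x x.
Proof.
have [->|/bform_gt0/ltW//] := eqVneq x 0.
by rewrite /bform mul0mx mul0mx mxE.
Qed.

Lemma bform_delta x j : bform x (delta_mx 0 j) = (x *m CQ) 0 j * (d j)%:~R.
Proof.
rewrite /bform trmx_delta -colE !mxE mulr_suml; apply: eq_bigr => i _.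
by rewrite !mxE intrM mulrA.
Qed.

Lemma delta_cartan i : delta_mx 0 i *m CQ = map_mx intr (row i C).
Proof. by rewrite -rowE map_row. Qed.

Lemma bform_delta_delta i j :
  bform (delta_mx 0 i) (delta_mx 0 j) = (C i j)%:~R * (d j)%:~R.
Proof. by rewrite bform_delta delta_cartan !mxE. Qed.

Lemma symmetrizable_cartan_unit : CQ \in unitmx.
Proof.
rewrite -row_free_unit -kermx_eq0; apply/rowV0P => x /sub_kermxP xC.
apply/eqP; apply: contraT => /bform_gt0.
suff -> : bform x x = 0 by rewrite ltxx.
rewrite /bform; have -> : CdQ = CQ *m diag_mx (\row_j (d j)%:~R).
  by apply/matrixP => i j; rewrite mul_mx_diag !mxE intrM.
by rewrite mulmxA xC !mul0mx mxE.
Qed.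

Lemma cartan_eq0_sym i j : C i j = 0 -> C j i = 0.
Proof.
move=> Cij; have /esym/eqP := Cd_sym i j.
by rewrite Cij mul0r mulf_eq0 (gt_eqF (d_gt0 i)) orbF => /eqP.
Qed.

(* The form takes the value [2 d_j (4 - C_ij C_ji)] at [C_ji alpha_i - 2 alpha_j]. *)
Lemma cartan_mul_lt4 i j : i != j -> C i j * C j i < 4.
Proof.
move=> ij; pose x : 'rV[rat]_n := (C j i)%:~R *: delta_mx 0 i - 2 *: delta_mx 0 j.
have x0 : x != 0.
  apply/eqP => /rowP/(_ j); rewrite !mxE !eqxx [j == i]eq_sym (negPf ij) /=.
  by rewrite mulr0 mulr1 add0r.
have := bform_gt0 x0.
have -> : bform x x = (2 * d j * (4 - C i j * C j i))%:~R.
  rewrite /x -scaleNr !(bformDl, bformDr, bformZl, bformZr) !bform_delta_delta !Cii.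
  by rewrite !(rmorphB, rmorphM) /=; ring.
by rewrite ltr0z; have := d_gt0 j; nia.
Qed.

Definition root_coord l : 'rV[rat]_n := map_mx intr l *m invmx CQ.

Lemma root_coordK l : root_coord l *m CQ = map_mx intr l.
Proof. by rewrite mulmxKV ?symmetrizable_cartan_unit. Qed.

Lemma root_coordD l mu : root_coord (l + mu) = root_coord l + root_coord mu.
Proof. by rewrite /root_coord map_mxD mulmxDl. Qed.

Lemma root_coord_mul (z : 'rV[int]_n) : root_coord (z *m C) = map_mx intr z.
Proof. by rewrite /root_coord map_mxM mulmxK ?symmetrizable_cartan_unit. Qed.

Lemma root_coord_refl i l :
  root_coord (refl C i l) = root_coord l + - (l 0 i)%:~R *: delta_mx 0 i.
Proof.
rewrite /root_coord /refl map_mxB map_mxZ mulmxBl -scalemxAl -delta_cartan.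
by rewrite mulmxK ?symmetrizable_cartan_unit // scaleNr.
Qed.

Lemma bform_root_coord l j :
  bform (root_coord l) (delta_mx 0 j) = (l 0 j)%:~R * (d j)%:~R.
Proof. by rewrite bform_delta root_coordK mxE. Qed.

Definition normsq l : rat := bform (root_coord l) (root_coord l).

Lemma bform_shift l j (t : rat) :
  let x := root_coord l + t *: delta_mx 0 j in
  bform x x = normsq l + (d j)%:~R * (2 * t * (l 0 j)%:~R + 2 * t ^+ 2).
Proof.
rewrite /= /normsq !(bformDl, bformDr, bformZl, bformZr) bform_delta_delta.
rewrite [bform (delta_mx 0 j) _]bform_sym !bform_root_coord Cii; ring.
Qed.

Lemma normsq_refl i l : normsq (refl C i l) = normsq l.
Proof. by rewrite {1}/normsq root_coord_refl bform_shift; ring. Qed.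

Lemma coord_le_normsq l j : `|l 0 j|%:~R <= 2 * normsq l.
Proof.
have := bform_ge0 (root_coord l + (- (l 0 j)%:~R / 2) *: delta_mx 0 j).
rewrite bform_shift => form_ge0.
have d_ge1 : 1 <= (d j)%:~R :> rat by rewrite ler1z; have := d_gt0 j; lia.
have abs_le_sqr : `|l 0 j|%:~R <= (l 0 j)%:~R ^+ 2 :> rat.
  by rewrite -rmorphXn ler_int; nia.
have sqr_ge0 : 0 <= (l 0 j)%:~R ^+ 2 :> rat by apply: sqr_ge0.
move: form_ge0 d_ge1 abs_le_sqr sqr_ge0.
by set a := (l 0 j)%:~R; set D := (d j)%:~R; nra.
Qed.

Lemma finite_normsq (c : rat) :
  exists B : {fset lat n}, forall l, normsq l <= c -> l \in B.
Proof.
pose N := Num.bound (2 * c).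
pose F (f : {ffun 'I_n -> 'I_(2 * N + 1)}) : lat n := \row_j ((f j : nat)%:Z - N%:Z).
exists (seq_fset tt (codom F)) => l le_c; rewrite seq_fsetE.
have lN j : (`|(l 0 j)%R| < N)%N.
  have c0 : 0 <= 2 * c by rewrite mulr_ge0 // (le_trans _ le_c) // bform_ge0.
  have : `|l 0 j|%:~R < N%:Z%:~R :> rat.
    apply: le_lt_trans (coord_le_normsq l j) (le_lt_trans _ (archi_boundP c0)).
    by rewrite ler_pM2l.
  by rewrite ltr_int; lia.
have bnd j : (`|(l 0 j + N%:Z)%R| < 2 * N + 1)%N by have := lN j; lia.
apply/codomP; exists [ffun j => Ordinal (bnd j)]; apply/rowP => j.
by rewrite !mxE ffunE /=; have := lN j; lia.
Qed.

Lemma bform_dominant_ge0 l (z : 'rV[int]_n) :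
  dominant l -> nonneg_row z -> 0 <= bform (root_coord l) (map_mx intr z).
Proof.
move=> dom z0; rewrite (row_sum_delta (map_mx intr z)).
elim/big_rec: _ => [|i x _ IH]; first by rewrite /bform trmx0 mulmx0 mxE.
rewrite bformDr bformZr bform_root_coord addr_ge0 // mxE !mulr_ge0 ?ler0z //.
exact/ltW.
Qed.

Lemma normsq_below nu lam :
  dominant nu -> dominant lam -> below C nu lam -> normsq nu <= normsq lam.
Proof.
move=> dom_nu dom_lam [z [z0 _ Elam]].
have := bform_dominant_ge0 dom_nu z0; have := bform_dominant_ge0 dom_lam z0.
rewrite /normsq Elam root_coordD root_coord_mul !(bformDl, bformDr).
by rewrite [bform (map_mx _ _) (root_coord nu)]bform_sym; lra.
Qed.

End InvariantForm.

Section FiniteCartan.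
Context (n : nat) (C : 'M[int]_n).
Hypothesis finC : finite_cartan C.
Implicit Types (l mu nu lam : lat n) (i j : 'I_n).

Definition invariant_norm (N : lat n -> rat) :=
  [/\ forall l, 0 <= N l,
      forall i l, N (refl C i l) = N l,
      forall c, exists B : {fset lat n}, forall l, N l <= c -> l \in B &
      forall nu lam, dominant nu -> dominant lam -> below C nu lam -> N nu <= N lam].

Lemma exists_invariant_norm : exists N, invariant_norm N.
Proof.
have [Cii _ [d [d_gt0 Cd_sym posdef]]] := finC; exists (normsq C d); split.
- by move=> l; apply: bform_ge0.
- exact: normsq_refl.
- exact: finite_normsq.
- exact: normsq_below.
Qed.

Lemma cartan_diag i : C i i = 2. Proof. by case: finC. Qed.

Lemma cartan_unit : map_mx (intr : int -> rat) C \in unitmx.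
Proof.
by case: finC => _ _ [d [_ _ posdef]]; apply: symmetrizable_cartan_unit posdef.
Qed.

Lemma cartan_pair_cases i j : i != j -> C j i <= C i j ->
  C i j = 0 /\ C j i = 0 \/
  C i j = -1 /\ [\/ C j i = -1, C j i = -2 | C j i = -3].
Proof.
move=> ij le_ji; have [Cii Cij_le0 [d [d_gt0 Cd_sym posdef]]] := finC.
have lt4 := cartan_mul_lt4 Cii d_gt0 Cd_sym posdef ij; have le0 := Cij_le0 i j ij.
have [Cij0|Cij_neq0] := eqVneq (C i j) 0.
  by left; split; last exact: cartan_eq0_sym Cij0.
right; have Cij : C i j = -1 by nia.
split=> //; have : C j i = -1 \/ C j i = -2 \/ C j i = -3 by lia.
by case=> [|[]] ->; [constructor 1|constructor 2|constructor 3].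
Qed.

Definition height l : rat := \sum_i (map_mx intr l *m invmx (map_mx intr C)) 0 i.

Lemma heightD l mu : height (l + mu) = height l + height mu.
Proof.
rewrite /height map_mxD mulmxDl -big_split.
by apply: eq_bigr => i _; rewrite [LHS]mxE.
Qed.

Lemma height_mul (z : 'rV[int]_n) : height (z *m C) = \sum_i (z 0 i)%:~R.
Proof.
by rewrite /height map_mxM mulmxK ?cartan_unit //; apply: eq_bigr => i _; rewrite mxE.
Qed.

Lemma height_below nu lam : below C nu lam -> height nu < height lam.
Proof.
move=> [z [z0 zn ->]]; rewrite heightD height_mul ltrDl lt_def.
have -> : 0 <= \sum_i (z 0 i)%:~R :> rat by apply: sumr_ge0 => i _; rewrite ler0z.
rewrite andbT; apply: contra_neq zn => /eqP.
rewrite psumr_eq0 => [/allP sum0|i _]; last by rewrite ler0z.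
by apply/rowP => i; have := sum0 i (mem_index_enum i); rewrite mxE intr_eq0 => /eqP.
Qed.

(** * Dominant weights of Weyl orbits *)

Lemma refl_coord i l : refl C i l 0 i = - l 0 i.
Proof. by rewrite !mxE cartan_diag; ring. Qed.

Lemma reflK i : involutive (refl C i).
Proof. by move=> l; rewrite {1}/refl refl_coord scaleNr opprK subrK. Qed.

Lemma reflD i l mu : refl C i (l + mu) = refl C i l + refl C i mu.
Proof. by rewrite /refl mxE scalerDl opprD addrACA. Qed.

Lemma in_orbit_ind (P : lat n -> Prop) l :
  P l -> (forall i mu, P mu -> P (refl C i mu)) -> forall mu, in_orbit C l mu -> P mu.
Proof. by move=> Pl Pr mu [w ->]; elim: w => //= i w IH; apply: Pr. Qed.

Lemma in_orbit_refl l mu i : in_orbit C l mu -> in_orbit C l (refl C i mu).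
Proof. by move=> [w ->]; exists (i :: w). Qed.

Lemma orbitP l mu : mu \in orbit C l <-> in_orbit C l mu.
Proof.
pose P (A : {fset lat n}) := forall mu, mu \in A <-> in_orbit C l mu.
suff /(epsilon_spec (inhabits fset0))/(_ mu) : exists A, P A by [].
have [N [_ N_refl N_finite _]] := exists_invariant_norm; have [B NB] := N_finite (N l).
exists [fset nu in B | classicb (in_orbit C l nu)] => nu; rewrite !inE /=.
case: classicbP => orb; rewrite ?andbT ?andbF; split=> // _.
by apply: NB; elim/in_orbit_ind: orb => // i nu'; rewrite N_refl.
Qed.

Lemma orbit_id l : l \in orbit C l.
Proof. by apply/orbitP; exists [::]. Qed.

Lemma card_orbit_gt0 l : (0 < #|` orbit C l|)%N.
Proof. by rewrite cardfs_gt0; apply/fset0Pn; exists l; apply: orbit_id. Qed.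

Inductive ascends : lat n -> lat n -> Prop :=
| ascends_refl l : ascends l l
| ascends_step i l lam : l 0 i < 0 -> ascends (refl C i l) lam -> ascends l lam.

Lemma ascends_trans l mu lam : ascends l mu -> ascends mu lam -> ascends l lam.
Proof. by elim=> // i {}l {}mu li _ IH /IH; apply: ascends_step. Qed.

Lemma ascends_below l lam : ascends l lam -> l = lam \/ below C l lam.
Proof.
elim=> [{}l|i {}l {}lam /below_refl-/(_ C) up _ [<-|]]; [by left|by right|].
by right; apply: below_trans up _.
Qed.

Lemma ascent_ind (P : lat n -> Prop) :
  (forall l, (forall i, l 0 i < 0 -> P (refl C i l)) -> P l) -> forall l, P l.
Proof.
move=> Pstep l0; have [N [_ N_refl N_finite _]] := exists_invariant_norm.
have [B NB] := N_finite (N l0); pose above l := [fset mu in B | (height l < height mu)%R].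
suff Pk k l : N l = N l0 -> (#|` above l| < k)%N -> P l.
  exact: (Pk _ _ erefl (ltnSn _)).
elim: k l => // k IHk l Nl; rewrite ltnS => card_le; apply: Pstep => i li.
apply: IHk; first by rewrite N_refl.
have up : height l < height (refl C i l) by apply/height_below/below_refl.
apply: leq_trans card_le; apply: fproper_ltn_card; rewrite fproperE; apply/andP; split.
  by apply/fsubsetP => mu; rewrite !inE => /andP[-> /(lt_trans up)].
apply/fsubsetPn; exists (refl C i l); rewrite !inE ?ltxx ?andbF //= up andbT.
by apply: NB; rewrite N_refl Nl.
Qed.

Lemma ascends_dominant l : exists2 lam, ascends l lam & dominant lam.
Proof.
elim/ascent_ind: l => l IH.
case: (boolP [exists i, l 0 i < 0]) => [/existsP[i li]|/existsPn l_ge0].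
  by have [lam ? ?] := IH i li; exists lam => //; apply: ascends_step li _.
by exists l; [apply: ascends_refl|move=> i; rewrite leNgt].
Qed.

Section RankTwo.
Implicit Types (p q : int).

Definition rank2_point i j nu p q : lat n := nu + p *: row i C + q *: row j C.

Lemma rank2_pointC i j nu p q : rank2_point i j nu p q = rank2_point j i nu q p.
Proof. exact: addrAC. Qed.

Lemma refl_rank2_point0 i j nu : refl C i nu = rank2_point i j nu (- nu 0 i) 0.
Proof. by rewrite /refl /rank2_point scale0r addr0 scaleNr. Qed.

Lemma ascends_rank2_l i j nu p q lam :
  nu 0 i + 2 * p + C j i * q < 0 ->
  ascends (rank2_point i j nu (- nu 0 i - p - C j i * q) q) lam ->
  ascends (rank2_point i j nu p q) lam.
Proof.
have -> : nu 0 i + 2 * p + C j i * q = rank2_point i j nu p q 0 i.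
  by rewrite !mxE cartan_diag; ring.
move=> lt0 asc; apply: ascends_step lt0 _; congr (ascends _ lam): asc.
by apply/rowP => k; rewrite !mxE cartan_diag; ring.
Qed.

Lemma ascends_rank2_r i j nu p q lam :
  nu 0 j + 2 * q + C i j * p < 0 ->
  ascends (rank2_point i j nu p (- nu 0 j - q - C i j * p)) lam ->
  ascends (rank2_point i j nu p q) lam.
Proof. by rewrite !(rank2_pointC i j); apply: ascends_rank2_l. Qed.

Lemma ascends_rank2_eq i j nu p q p' q' :
  p = p' -> q = q' -> ascends (rank2_point i j nu p q) (rank2_point i j nu p' q').
Proof. by move=> -> ->; apply: ascends_refl. Qed.

Ltac climb Cij Cji := repeat first
  [ by apply: ascends_rank2_eq; lia
  | apply: ascends_rank2_l; rewrite ?Cij ?Cji; [by lia|]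
  | apply: ascends_rank2_r; rewrite ?Cij ?Cji; [by lia|] ].

(* The witness is the image of [nu] under the longest element of the rank two
   Weyl group, reached by its two reduced words. *)
Lemma ascends_diamond_le i j nu :
  i != j -> C j i <= C i j -> nu 0 i < 0 -> nu 0 j < 0 ->
  exists2 tau, ascends (refl C i nu) tau & ascends (refl C j nu) tau.
Proof.
move=> ij le_ji i0 j0.
rewrite (refl_rank2_point0 i j) (refl_rank2_point0 j i) (rank2_pointC j).
pose pt := rank2_point i j nu.
case: (cartan_pair_cases ij le_ji) => [[Cij Cji]|[Cij [] Cji]].
- by exists (pt (- nu 0 i) (- nu 0 j)); climb Cij Cji.
- by exists (pt (- nu 0 i - nu 0 j) (- nu 0 i - nu 0 j)); climb Cij Cji.
- by exists (pt (- 2 * nu 0 i - 2 * nu 0 j) (- nu 0 i - 2 * nu 0 j)); climb Cij Cji.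
- by exists (pt (- 4 * nu 0 i - 6 * nu 0 j) (- 2 * nu 0 i - 4 * nu 0 j)); climb Cij Cji.
Qed.

Lemma ascends_diamond i j nu : i != j -> nu 0 i < 0 -> nu 0 j < 0 ->
  exists2 tau, ascends (refl C i nu) tau & ascends (refl C j nu) tau.
Proof.
move=> ij i0 j0; have [le_ji|/ltW le_ij] := leP (C j i) (C i j).
  exact: ascends_diamond_le.
have ji : j != i by rewrite eq_sym.
by have [tau ? ?] := ascends_diamond_le ji le_ij j0 i0; exists tau.
Qed.

End RankTwo.

Lemma ascends_dominant_refl lam lam' : dominant lam -> ascends lam lam' -> lam = lam'.
Proof. by move=> dom asc; case: asc dom => // i l mu li _ /(_ i); rewrite leNgt li. Qed.

Lemma ascends_unique l lam lam' :
  ascends l lam -> ascends l lam' -> dominant lam -> dominant lam' -> lam = lam'.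
Proof.
elim/ascent_ind: l lam lam' => l IH lam lam' asc asc' dom dom'.
case: asc dom asc' IH => [{}l|i {}l {}lam li asc] dom asc' IH.
  exact: ascends_dominant_refl.
case: asc' dom' li asc IH => [{}l|j {}l {}lam' lj asc'] dom' li asc IH.
  by move: (dom' i); rewrite leNgt li.
have [ij|ij] := eqVneq i j; first by apply: (IH i li) => //; rewrite ij.
have [tau asc_i asc_j] := ascends_diamond ij li lj.
have [sig asc_sig dom_sig] := ascends_dominant tau.
rewrite (IH i li lam sig) //; last exact: ascends_trans asc_sig.
by apply/esym; apply: (IH j lj) => //; apply: ascends_trans asc_sig.
Qed.

Lemma orbit_ascends lam mu : dominant lam -> in_orbit C lam mu -> ascends mu lam.
Proof.
move=> dom; elim/in_orbit_ind => [|i nu asc]; first exact: ascends_refl.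
case: (ltgtP (nu 0 i) 0) => nui.
- have [sig asc_sig dom_sig] := ascends_dominant (refl C i nu).
  by rewrite -(ascends_unique (ascends_step nui asc_sig) asc dom_sig dom).
- by apply: (@ascends_step i); rewrite ?refl_coord ?oppr_lt0 ?reflK.
- by rewrite /refl nui scale0r subr0.
Qed.

(** * Invariants of the Weyl group *)

Definition leading lam (f : ZL n) :=
  exists r, f = ex lam + r /\ supp_in (fun mu => below C mu lam) r.

Lemma leading1 : leading 0 1.
Proof. by exists 0; split; [rewrite addr0|apply: subgroup0 (supp_in_subgroup _)]. Qed.

Lemma leadingM lam lam' f f' :
  leading lam f -> leading lam' f' -> leading (lam + lam') (f * f').
Proof.
move=> [r [-> supp_r]] [r' [-> supp_r']].
exists (ex lam * r' + r * ex lam' + r * r'); split.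
  by rewrite -exM mulrDl !mulrDr !addrA.
have supp_ex mu : supp_in (fun nu => nu = mu) (ex mu) by apply: supp_inU.
apply: (subgroupD (supp_in_subgroup _)); first apply: (subgroupD (supp_in_subgroup _)).
- by apply: supp_inM (supp_ex lam) supp_r' => k1 k2 ->; apply: below_addl.
- apply: supp_inM supp_r (supp_ex lam') => k1 k2 bel ->.
  by rewrite addrC [lam + _]addrC; apply: below_addl.
- by apply: supp_inM supp_r supp_r' => k1 k2; apply: belowD.
Qed.

Lemma leading_rho lam : dominant lam -> leading lam (rho C lam).
Proof.
move=> dom; exists (\sum_(mu <- orbit C lam `\ lam) ex mu); split.
  by rewrite /rho (big_fsetD1 lam) ?orbit_id.
rewrite big_seq; apply: (subgroup_sum (supp_in_subgroup _)) => mu.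
rewrite !inE => /andP[ne /orbitP orb]; apply: supp_inU.
by have [E|//] := ascends_below (orbit_ascends dom orb); rewrite E eqxx in ne.
Qed.

Lemma leading_coef lam f : leading lam f -> f@_lam = 1.
Proof.
move=> [r [-> supp_r]]; rewrite mcoeffD mcoeffUU.
have [->|/eqP/supp_r/height_below] := r@_lam =P 0; first by rewrite addr0.
by rewrite ltxx.
Qed.

Lemma supp_sub_leading lam f g : leading lam g ->
  supp_in (fun nu => nu != lam /\ (f@_nu != 0 \/ below C nu lam)) (f - g *~ f@_lam).
Proof.
move=> lead nu; rewrite mcoeffB raddfMz /=.
have [->|ne] := eqVneq nu lam; first by rewrite (leading_coef lead) intz subrr eqxx.
have [->|f_neq0] := eqVneq f@_nu 0; last by split=> //; left.
rewrite sub0r oppr_eq0 mulrz_eq0 negb_or => /andP[_ g_nu]; split=> //; right.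
case: lead g_nu => r [-> supp_r].
by rewrite mcoeffD mcoeffU [lam == nu]eq_sym (negPf ne) add0r; apply: supp_r.
Qed.

Lemma mcoeff_wact i f mu : (wact C i f)@_mu = f@_(refl C i mu).
Proof.
rewrite /wact raddf_sum /=.
have refl_eq nu : (refl C i nu == mu) = (nu == refl C i mu).
  exact: (can2_eq (reflK i) (reflK i)).
under eq_bigr do rewrite mcoeffU refl_eq.
case: (msuppP f (refl C i mu)) => muf.
  rewrite (big_fsetD1 _ muf) /= eqxx big_seq big1 ?addr0 // => nu.
  by rewrite !inE => /andP[/negPf -> _].
rewrite big_seq big1 // => nu nuf; case: eqP => // E.
by rewrite -E nuf in muf.
Qed.

Fact wact_is_additive i : zmod_morphism (wact C i).
Proof.
move=> f g; apply/malgP => mu.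
apply: etrans (mcoeff_wact i _ mu) _; apply: etrans (mcoeffB _ _ _) _.
by rewrite mcoeffB; congr (_ - _); apply/esym/mcoeff_wact.
Qed.

HB.instance Definition _ i :=
  GRing.isZmodMorphism.Build (ZL n) (ZL n) (wact C i) (wact_is_additive i).

Lemma wactU i c l : wact C i << c *g l >> = << c *g refl C i l >>.
Proof.
apply/malgP => mu; rewrite mcoeff_wact !mcoeffU; congr (_ *+ (_ : bool)).
by rewrite eq_sym (can2_eq (reflK i) (reflK i)) eq_sym.
Qed.

Lemma wactM i : {morph wact C i : f g / f * g}.
Proof.
apply: (grpalg_morphM (wact_is_additive i)) => c k c' k'.
rewrite grpalgUM; apply: etrans (wactU _ _ _) _; rewrite reflD -grpalgUM.
by apply/esym; apply: congr2 (wactU _ _ _) (wactU _ _ _).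
Qed.

Lemma W_invariantP f : W_invariant C f <-> forall i mu, f@_(refl C i mu) = f@_mu.
Proof.
split=> [inv i mu|inv i]; first by rewrite -mcoeff_wact inv.
by apply/malgP => mu; rewrite mcoeff_wact.
Qed.

Lemma W_invariant_subgroup : is_subgroup (W_invariant C).
Proof.
split=> [i|f g inv_f inv_g i]; first exact: raddf0.
by apply: etrans (raddfB (wact C i) f g) _; congr (_ - _); [exact: inv_f|exact: inv_g].
Qed.

Lemma W_invariant1 : W_invariant C 1.
Proof. by move=> i; rewrite -ex0 wactU /refl mxE scale0r subr0. Qed.

Lemma W_invariantM f g : W_invariant C f -> W_invariant C g -> W_invariant C (f * g).
Proof.
move=> inv_f inv_g i; apply: etrans (wactM i f g) _.
by congr (_ * _); [exact: inv_f|exact: inv_g].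
Qed.

Lemma mcoeff_rho l mu : (rho C l)@_mu = (mu \in orbit C l)%:R.
Proof.
rewrite /rho raddf_sum /=; case: (boolP (mu \in _)) => mu_orb.
  rewrite (big_fsetD1 mu) //= mcoeffUU big_seq big1 ?addr0 // => k.
  by rewrite !inE mcoeffU => /andP[/negPf ->].
rewrite big_seq big1 // => k k_orb; rewrite mcoeffU; case: eqP => // E.
by rewrite -E k_orb in mu_orb.
Qed.

Lemma W_invariant_rho l : W_invariant C (rho C l).
Proof.
apply/W_invariantP => i mu; rewrite !mcoeff_rho; congr (_ : bool)%:R.
apply/idP/idP => /orbitP orb; apply/orbitP; last exact: in_orbit_refl.
by rewrite -(reflK i mu); apply: in_orbit_refl.
Qed.

Lemma augm_rho l : augm (rho C l) = #|` orbit C l|%:R.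
Proof.
rewrite /rho raddf_sum /= big_seq (eq_bigr (fun=> 1)) => [|mu _]; last exact: augmU.
by rewrite -big_seq big_const_seq count_predT iter_addr_0.
Qed.

Definition rho_ideal := ideal_of (rhoj C) n.

Definition constant_mod_rho f := rho_ideal (f - (augm f)%:~R).

Lemma constant_mod_rhoM f g :
  constant_mod_rho f -> constant_mod_rho g -> constant_mod_rho (f * g).
Proof.
move=> const_f const_g; rewrite /constant_mod_rho rmorphM /= intrM.
have -> : f * g - (augm f)%:~R * (augm g)%:~R
   = f * (g - (augm g)%:~R) + (augm g)%:~R * (f - (augm f)%:~R) by ring.
have [subI IMl] := ideal_of_is_ideal (rhoj C) n.
by apply: (subgroupD subI); apply: IMl.
Qed.

Lemma constant_mod_rhoD f g :
  constant_mod_rho f -> constant_mod_rho g -> constant_mod_rho (f + g).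
Proof.
move=> const_f const_g; rewrite /constant_mod_rho rmorphD /= intrD opprD addrACA.
by apply: (subgroupD (proj1 (ideal_of_is_ideal _ _))).
Qed.

Lemma constant_mod_rho_int (z : int) : constant_mod_rho z%:~R.
Proof.
rewrite /constant_mod_rho rmorph_int intz subrr.
exact: subgroup0 (proj1 (ideal_of_is_ideal _ _)).
Qed.

Lemma constant_mod_rho_rhoo j : constant_mod_rho (rhoo C j).
Proof. by rewrite /constant_mod_rho augm_rho natz -pmulrn; apply: ideal_of_gen. Qed.

Definition weight_monomial lam : ZL n := \prod_(j < n) rhoo C j ^+ `|(lam 0 j)%R|%N.

Lemma weight_monomial_ind (P : lat n -> ZL n -> Prop) :
  P 0 1 -> (forall l f mu g, P l f -> P mu g -> P (l + mu) (f * g)) ->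
  (forall j : 'I_n, P (omegan n j) (rhoo C j)) ->
  forall lam, dominant lam -> P lam (weight_monomial lam).
Proof.
move=> P1 PM Prho lam dom.
have {1}-> : lam = \sum_(j < n) omegan n j *+ `|(lam 0 j)%R|%N.
  apply/rowP => k; rewrite summxE (bigD1 k) //= big1 ?addr0.
    by rewrite mulmxnE mxE eqxx; have := dom k; lia.
  by move=> j jk; rewrite mulmxnE mxE eq_sym (inj_eq val_inj) (negPf jk) mul0rn.
apply: (big_ind2 P) => [|f l g mu|j _]; [exact: P1|exact: PM|].
by elim: `|_|%N => [|k IH]; rewrite ?mulrS ?exprS; [exact: P1|apply: PM].
Qed.

Lemma dominant_omega (j : nat) : dominant (omegan n j).
Proof. by move=> i; rewrite mxE; case: eqP. Qed.

Lemma leading_weight_monomial lam : dominant lam -> leading lam (weight_monomial lam).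
Proof.
apply: weight_monomial_ind => [||j]; first exact: leading1.
  by move=> *; apply: leadingM.
exact/leading_rho/dominant_omega.
Qed.

Lemma W_invariant_weight_monomial lam :
  dominant lam -> W_invariant C (weight_monomial lam).
Proof.
apply: (@weight_monomial_ind (fun _ => W_invariant C)) => [||j].
- exact: W_invariant1.
- by move=> *; apply: W_invariantM.
- exact: W_invariant_rho.
Qed.

Lemma constant_mod_rho_weight_monomial lam :
  dominant lam -> constant_mod_rho (weight_monomial lam).
Proof.
apply: (@weight_monomial_ind (fun _ => constant_mod_rho)) => [||j].
- exact: (constant_mod_rho_int 1).
- by move=> *; apply: constant_mod_rhoM.
- exact: constant_mod_rho_rhoo.
Qed.

Lemma W_invariant_eq0 f :
  W_invariant C f -> (forall lam, dominant lam -> f@_lam = 0) -> f = 0.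
Proof.
move=> /W_invariantP inv f0; apply/malgP => l; rewrite mcoeff0.
have [lam asc dom] := ascends_dominant l; rewrite -(f0 lam dom).
by elim: asc => // i {}l {}lam' _ _ <-; rewrite inv.
Qed.

Definition saturated (B : {fset lat n}) :=
  (forall mu, mu \in B -> dominant mu) /\
  forall nu mu, mu \in B -> dominant nu -> below C nu mu -> nu \in B.

Lemma saturated_rem_highest B : saturated B -> B != fset0 ->
  exists2 mu, mu \in B & saturated (B `\ mu).
Proof.
move=> [domB downB] /fset0Pn[b bB].
case: (arg_maxP (i0 := [` bB]) (P := predT) (fun x : B => height (val x))) => //=.
move=> [mu muB] _ highest; exists mu => //; split=> [nu|nu nu'].
  by rewrite !inE => /andP[_ /domB].
rewrite !inE => /andP[_ nu'B] dom bel; rewrite (downB nu nu') // andbT.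
apply: contraTneq (height_below bel) => ->; rewrite -leNgt.
exact: (highest [` nu'B]).
Qed.

Lemma W_invariant_constant_mod_rho_on B f : saturated B -> W_invariant C f ->
  (forall mu, dominant mu -> f@_mu != 0 -> mu \in B) -> constant_mod_rho f.
Proof.
have [k] := ubnP #|` B|; elim: k B f => // k IH B f.
rewrite ltnS => card_B satB inv supp_f.
have [B0|/(saturated_rem_highest satB)[mu muB sat]] := eqVneq B fset0.
  suff -> : f = 0 by exact: (constant_mod_rho_int 0).
  apply: W_invariant_eq0 inv _ => lam dom; apply/eqP/negPn/negP => /(supp_f lam dom).
  by rewrite B0.
have [domB downB] := satB; have dom_mu := domB mu muB.
pose g := weight_monomial mu *~ f@_mu; rewrite -(subrK g f).
apply: constant_mod_rhoD; last first.
  rewrite /g -mulrzl; apply: constant_mod_rhoM (constant_mod_rho_int _) _.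
  exact: constant_mod_rho_weight_monomial.
apply: IH sat _ _; first by move: card_B; rewrite (cardfsD1 mu) muB.
  apply: (subgroupB W_invariant_subgroup) inv (subgroupMz W_invariant_subgroup _ _).
  exact: W_invariant_weight_monomial.
move=> nu dom_nu /(supp_sub_leading (leading_weight_monomial dom_mu))[ne supp].
by rewrite !inE ne; case: supp => [/(supp_f nu dom_nu)|/(downB _ _ muB dom_nu)].
Qed.

Lemma W_invariant_constant_mod_rho f : W_invariant C f -> constant_mod_rho f.
Proof.
move=> inv; have [N [N_ge0 _ N_finite N_below]] := exists_invariant_norm.
pose c := \sum_(mu <- msupp f) N mu; have [B NB] := N_finite c.
pose B' := [fset mu in B | classicb (dominant mu) && (N mu <= c)].
have B'P mu : mu \in B' <-> dominant mu /\ N mu <= c.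
  rewrite !inE /=; split=> [/and3P[_ /classicbP]//|[dom le_c]].
  by rewrite NB //= le_c andbT; apply/classicbP.
apply: (@W_invariant_constant_mod_rho_on B') => //.
  split=> [mu /B'P[]//|nu mu /B'P[dom_mu le_c] dom_nu bel].
  by apply/B'P; split=> //; apply: le_trans (N_below _ _ _ _ bel) le_c.
move=> mu dom; rewrite mcoeff_neq0 => mu_f; apply/B'P; split=> //.
by rewrite /c (big_fsetD1 mu mu_f) /= lerDl sumr_ge0.
Qed.

Lemma I_scP f : I_sc C f <-> rho_ideal f.
Proof.
split=> [|[F ->]].
  apply: gen_ideal_sub (ideal_of_is_ideal _ _) _ => g [inv aug].
  by have := W_invariant_constant_mod_rho inv; rewrite /constant_mod_rho aug subr0.
apply: gen_ideal_sum => j; apply: gen_ideal_mul => //; split; last first.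
  by rewrite raddfB /= augm_rho rmorph_nat subrr.
apply: (subgroupB W_invariant_subgroup); first exact: W_invariant_rho.
by rewrite pmulrn; apply: (subgroupMz W_invariant_subgroup); apply: W_invariant1.
Qed.

End FiniteCartan.

(** * The sublattice of index two *)

Section IndexTwo.
Context (n : nat) (C : 'M[int]_n) (T : lat n -> Prop) (n' : nat).
Context (a : nat -> nat -> int) (l0 : lat n).
Hypothesis finC : finite_cartan C.
Hypothesis subT : is_subgroup T.
Hypothesis T_index2 : exists l1, ~ T l1 /\ forall mu, T mu \/ T (mu - l1).
Hypothesis T_root : forall i, T (row i C).
Hypothesis n'_le : (n' <= n)%N.
Hypothesis T_omega : forall i : 'I_n, ~ T (omegan n i) <-> (i < n')%N.
Hypothesis bezout : forall i, (i < n')%N ->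
  (dd C n' i)%:Z = \sum_(i <= j < n') a i j * (ssz C j)%:Z.
Hypothesis Tl0 : ~ T l0.
Implicit Types (f g F : ZL n) (l mu : lat n) (j : nat).

Let odd_sub l mu : ~ T l -> ~ T mu -> T (l - mu).
Proof. exact: index2_subr. Qed.

Let odd_add l mu : ~ T l -> ~ T mu -> T (l + mu).
Proof.
move=> Tl Tmu; rewrite -[mu]opprK; apply: odd_sub => // /(subgroupN subT).
by rewrite opprK.
Qed.

Lemma odd_omega j : (j < n')%N -> ~ T (omegan n j).
Proof. by move=> lt_jn'; apply/(T_omega (Ordinal (leq_trans lt_jn' n'_le))). Qed.

Lemma even_omega j : (n' <= j < n)%N -> T (omegan n j).
Proof.
case/andP=> le_n'j lt_jn; apply/classicbP/negPn/negP => /classicbP.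
by move/(T_omega (Ordinal lt_jn)) => /=; rewrite ltnNge le_n'j.
Qed.

Lemma n'_gt0 : (0 < n')%N.
Proof.
rewrite lt0n; apply/eqP => n'0; apply: Tl0.
rewrite (row_sum_delta l0); apply: subgroup_sum => // i _.
rewrite -[l0 0 i]intz scaler_int; apply: subgroupMz => //.
have -> : delta_mx 0 i = omegan n i by apply/rowP => k; rewrite !mxE eqxx.
by apply: even_omega; rewrite n'0 /=.
Qed.

Lemma in_orbit_sub l mu : in_orbit C l mu -> T (mu - l).
Proof.
elim/in_orbit_ind => [|i nu IH]; first by rewrite subrr; apply: subgroup0 subT.
rewrite /refl addrAC -[nu 0 i]intz scaler_int; apply: (subgroupB subT) => //.
exact: subgroupMz.
Qed.

Lemma homogeneous_rho l : homogeneous T l (rho C l).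
Proof.
rewrite /rho big_seq; apply: (subgroup_sum (homogeneous_subgroup T l)) => mu.
by move/(orbitP finC)/in_orbit_sub => Tmul; apply: supp_inU.
Qed.

Lemma rhotwE i : (i < n')%N -> rhotw C n' a i = bezout_comb n' a (rhoo C) i.
Proof.
move=> lt_in'; rewrite /rhotw /rhot pmulrn bezout // rmorph_sum /= -big_split /=.
by apply: eq_bigr => k _; rewrite /rhoj pmulrn intrM mulrBr subrK mulrzl.
Qed.

Lemma homogeneous_rhotw i : (i < n')%N -> homogeneous T l0 (rhotw C n' a i).
Proof.
move=> lt_in'; rewrite rhotwE // /bezout_comb big_nat.
apply: (subgroup_sum (homogeneous_subgroup T l0)) => k /andP[_ lt_kn'].
apply: (subgroupMz (homogeneous_subgroup T l0)).
apply: (homogeneous_congr subT (odd_sub (odd_omega lt_kn') Tl0)).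
exact: homogeneous_rho.
Qed.

Lemma ssz_gt0 j : (0 < ssz C j)%N. Proof. exact: card_orbit_gt0. Qed.

Lemma rho_ideal_rhot i : rho_ideal C (rhot C n' a i).
Proof.
have [subI IMl] := ideal_of_is_ideal (rhoj C) n.
rewrite /rhot big_nat; apply: (subgroup_sum subI) => k /andP[_ lt_kn'].
by apply/IMl/ideal_of_gen/(leq_trans lt_kn').
Qed.

Lemma gens_h_homogeneous g : gens_h C n' a l0 g -> homogeneous T 0 g.
Proof.
have homB l := subgroupB (@homogeneous_subgroup _ int T l).
have homM l l' f := @homogeneousM _ int T subT l l' f.
have hom_nat m := @homogeneous_nat _ int T subT m.
case=> [[i [lt_in' ->]]|[[i [lt_in' ->]]|[i [/andP[le_n'i lt_in] ->]]]].
- have Tl0l0 : T (l0 + (0 + l0) - 0) by rewrite subr0 add0r; apply: odd_add.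
  apply: (homogeneous_congr subT Tl0l0); apply: (homM); first exact: homogeneousU.
  apply: (homB); apply: (homM) => //; last exact: homogeneous_rhotw.
  apply: (homogeneous_congr subT (odd_sub (odd_omega (ltnW lt_in')) Tl0)).
  exact: homogeneous_rho.
- apply: (homB) => //; apply: (@homogeneous_congr _ _ _ subT (omegan n i + l0)).
    by rewrite subr0; apply: odd_add (odd_omega lt_in') Tl0.
  by apply: (homM); [exact: homogeneous_rho|exact: homogeneous_rhotw n'_gt0].
- have Ti : T (omegan n i - 0) by rewrite subr0; apply: even_omega; rewrite le_n'i.
  by apply: (homB) => //; apply: (homogeneous_congr subT Ti); apply: homogeneous_rho.
Qed.

Lemma gens_h_rho_ideal g : gens_h C n' a l0 g -> rho_ideal C g.
Proof.
have [subI IMl] := ideal_of_is_ideal (rhoj C) n.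
case=> [[i [lt_in' ->]]|[[i [lt_in' ->]]|[i [/andP[_ lt_in] ->]]]].
- have -> : h1 C n' a l0 i = ex l0 * ((rr C n' i %/ ssz C i)%:R * rhoj C i
      - (rr C n' i %/ dd C n' i.+1)%:R * rhot C n' a i.+1).
    congr (_ * _); have -> : rhoo C i = rhoj C i + (ssz C i)%:R by rewrite subrK.
    rewrite !mulrDr -!natrM divnK ?dvdn_lcml // divnK ?dvdn_lcmr //.
    by rewrite opprD addrACA subrr addr0.
  apply: (IMl); apply: (subgroupB subI); apply: (IMl); last exact: rho_ideal_rhot.
  exact/ideal_of_gen/(leq_trans (ltnW lt_in')).
- have -> : h2 C n' a i = rhoo C i * rhot C n' a 0 + (dd C n' 0)%:R * rhoj C i.
    by rewrite /h2 /rhotw /rhoj natrM; ring.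
  apply: (subgroupD subI); apply: (IMl); first exact: rho_ideal_rhot.
  exact/ideal_of_gen/(leq_trans lt_in').
- exact: ideal_of_gen.
Qed.

Let h_ideal := gen_ideal (fun=> True) (gens_h C n' a l0).
Let d := dd C n' 0.
Let ssz_quo j := (ssz C j %/ d)%N.

Lemma dd_dvd_ssz j : (j < n')%N -> (d %| ssz C j)%N.
Proof. by move=> lt_jn'; apply: tail_gcd_dvd. Qed.

Lemma rhoo_sub_rhotw_in_h_ideal j :
  (j < n')%N -> h_ideal (rhoo C j - (ssz_quo j)%:R * rhotw C n' a 0).
Proof.
move=> lt_jn'; have [sub_h_ideal h_idealMl] := gen_ideal_is_ideal (gens_h C n' a l0).
rewrite rhotwE ?n'_gt0 // mulr_natl.
apply: (sub_bezout_comb_in_subgroup ssz_gt0 bezout sub_h_ideal) => // i lt_in' /=.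
rewrite -[_ - _](exNK l0); apply: h_idealMl; apply: gen_ideal_gen; left; exists i.
by split=> //; rewrite /h1 rhotwE // !mulr_natl.
Qed.

Lemma component_rhojM l F j : component T l (F * rhoj C j) =
  component T (l - omegan n j) F * rhoo C j - (ssz C j)%:R * component T l F.
Proof.
rewrite mulrBr raddfB /= (componentM subT _ _ (@homogeneous_rho (omegan n j))).
by rewrite [F * _%:R]mulrC component_natM.
Qed.

Lemma component_shift_even l F j : (n' <= j < n)%N ->
  component T (l - omegan n j) F = component T l F.
Proof.
move/even_omega => Tj; apply: (component_congr subT).
by rewrite addrAC subrr sub0r; apply: subgroupN.
Qed.

Lemma component_shift_odd F j : (j < n')%N ->
  component T (0 - omegan n j) F = component T l0 F /\
  component T (l0 - omegan n j) F = component T 0 F.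
Proof.
move/odd_omega => Tj; split; apply: (component_congr subT); rewrite ?sub0r ?subr0.
  by rewrite -opprD addrC; apply/(subgroupN subT)/odd_add.
exact: odd_sub.
Qed.

Lemma component_sub_shift_divisible F j : (j < n)%N ->
  (ssz C j)%:R * (component T l0 F - component T (l0 - omegan n j) F) =
  d%:R * ((ssz_quo j)%:R * (component T l0 F - component T (l0 - omegan n j) F)).
Proof.
move=> lt_jn; have [lt_jn'|le_n'j] := ltnP j n'.
  by rewrite mulrA -natrM mulnC divnK ?dd_dvd_ssz.
by rewrite component_shift_even ?le_n'j // subrr !mulr0.
Qed.

Lemma odd_component_eq0 f : homogeneous T 0 f -> component T l0 f = 0.
Proof.
move=> homf; apply: (component_eq0 subT _ homf); rewrite sub0r => /(subgroupN subT).
by rewrite opprK.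
Qed.

Lemma exists_divisible_components f : gen_flatness (fun i : 'I_n => rhoj C i) ->
  homogeneous T 0 f -> rho_ideal C f ->
  exists F : 'I_n -> ZL n, f = \sum_j F j * rhoj C j /\
    forall j : 'I_n, exists v, component T (l0 - omegan n j) (F j) = d%:R * v.
Proof.
move=> flat homf [F Ef].
pose g : 'cV[ZL n]_n := \col_j component T (l0 - omegan n j) (F j).
pose w := \sum_(j < n) (ssz_quo j)%:R * (component T l0 (F j) - g j 0).
have syz : (\row_j rhoj C j) *m g = (d%:R * w)%:M.
  apply/matrixP => i k; rewrite !ord1 !mxE eqxx mulr1n.
  transitivity (\sum_(j < n) component T l0 (F j * rhoj C j) + d%:R * w); last first.
    by rewrite -raddf_sum -Ef /= odd_component_eq0 // add0r.
  rewrite mulr_sumr -big_split; apply: eq_bigr => j _ /=.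
  by rewrite !mxE -component_sub_shift_divisible // component_rhojM /rhoj; ring.
have [u [v [u0 Eg]]] := gen_flatness_syzygy_lift flat syz.
exists (fun j : 'I_n => F j - u j 0); split=> [|j].
  under eq_bigr do rewrite mulrBl; rewrite sumrB -Ef -[LHS]subr0; congr (_ - _).
  move/matrixP/(_ 0 0): u0; rewrite !mxE => u0; rewrite -[LHS]u0.
  by apply: eq_bigr => j _; rewrite mxE mulrC.
exists (component T (l0 - omegan n j) (v j 0)).
have -> : u j 0 = component T (l0 - omegan n j) (F j) - d%:R * v j 0.
  have : g j 0 = (u + d%:R *: v) j 0 by rewrite Eg.
  by rewrite [g j 0]mxE [(u + _) j 0]mxE [(_ *: v) j 0]mxE => ->; rewrite addrK.
rewrite opprB addrCA raddfD raddfB /= component_natM.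
by rewrite (component_id (@homogeneous_component _ _ _ _ _)) subrr addr0.
Qed.

(* [rhotw 0] is odd and congruent to [d] modulo the augmentation ideal, so an
   odd component divisible by [d] can be folded into the even one. *)
Definition foldable f :=
  exists b, d%:R * b = component T l0 f /\ h_ideal (component T 0 f + rhotw C n' a 0 * b).

Lemma foldable_subgroup : is_subgroup foldable.
Proof.
have [sub_h_ideal _] := gen_ideal_is_ideal (gens_h C n' a l0).
split=> [|f g [b [db Mb]] [b' [db' Mb']]].
  by exists 0; rewrite !raddf0 !mulr0 addr0; split=> //; apply: subgroup0 sub_h_ideal.
exists (b - b'); rewrite !raddfB /= !mulrBr db db'; split=> //.
by rewrite addrACA -opprD; apply: (subgroupB sub_h_ideal).
Qed.

Lemma foldable_mul_rhoj_even F v j : (n' <= j < n)%N ->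
  component T (l0 - omegan n j) F = d%:R * v -> foldable (F * rhoj C j).
Proof.
move=> jn Ev; have [_ h_idealMl] := gen_ideal_is_ideal (gens_h C n' a l0).
have Mh : h_ideal (rhoj C j) by apply: gen_ideal_gen; right; right; exists j.
exists (v * rhoj C j); rewrite !component_rhojM Ev.
split; first by rewrite -(component_shift_even l0 F jn) Ev /rhoj; ring.
rewrite component_shift_even //.
have -> : component T 0 F * rhoo C j - (ssz C j)%:R * component T 0 F +
    rhotw C n' a 0 * (v * rhoj C j) =
    (component T 0 F + rhotw C n' a 0 * v) * rhoj C j by rewrite /rhoj; ring.
exact: h_idealMl.
Qed.

Lemma foldable_mul_rhoj_odd F v j : (j < n')%N ->
  component T (l0 - omegan n j) F = d%:R * v -> foldable (F * rhoj C j).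
Proof.
move=> lt_jn' Ev; have [sub_h_ideal h_idealMl] := gen_ideal_is_ideal (gens_h C n' a l0).
have Mh : h_ideal (h2 C n' a j) by apply: gen_ideal_gen; right; left; exists j.
have [shift0 shiftl0] := component_shift_odd F lt_jn'.
exists (v * rhoo C j - (ssz_quo j)%:R * component T l0 F); rewrite !component_rhojM Ev.
split; first by rewrite mulrBr !mulrA -natrM mulnC divnK ?dd_dvd_ssz.
rewrite shift0 -shiftl0 Ev.
have -> : component T l0 F * rhoo C j - (ssz C j)%:R * (d%:R * v) +
    rhotw C n' a 0 * (v * rhoo C j - (ssz_quo j)%:R * component T l0 F) =
    component T l0 F * (rhoo C j - (ssz_quo j)%:R * rhotw C n' a 0) + v * h2 C n' a j.
  by rewrite /h2 natrM -/d; ring.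
apply: (subgroupD sub_h_ideal); apply: h_idealMl => //.
exact: rhoo_sub_rhotw_in_h_ideal.
Qed.

Lemma foldable_homogeneous0 f : homogeneous T 0 f -> foldable f -> h_ideal f.
Proof.
move=> homf [b [db]]; rewrite (component_id homf).
suff -> : b = 0 by rewrite mulr0 addr0.
apply: (@natM_eq0 _ d); first exact: (tail_gcd_gt0 ssz_gt0 n'_gt0).
by rewrite db odd_component_eq0.
Qed.

Lemma homogeneous_rho_ideal_in_h_ideal f : gen_flatness (fun i : 'I_n => rhoj C i) ->
  homogeneous T 0 f -> rho_ideal C f -> h_ideal f.
Proof.
move=> flat homf /(exists_divisible_components flat homf)[F [Ef divF]].
apply: foldable_homogeneous0 => //; rewrite Ef.
apply: (subgroup_sum foldable_subgroup) => j _; have [v Ev] := divF j.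
have [lt_jn'|le_n'j] := ltnP j n'; first exact: foldable_mul_rhoj_odd Ev.
by apply: foldable_mul_rhoj_even Ev; rewrite le_n'j /=.
Qed.

End IndexTwo.

Theorem theorem3p4 (n : nat) (C : 'M[int]_n) (T : lat n -> Prop) (n' : nat)
    (a : nat -> nat -> int) (l0 : lat n) :
  finite_cartan C ->
  (* T : a subgroup of index 2 of Lambda containing the root lattice *)
  T 0 -> (forall x y, T x -> T y -> T (x - y)) ->
  (exists l1, ~ T l1 /\ forall mu, T mu \/ T (mu - l1)) ->
  (forall i, T (row i C)) ->
  (* ordering: omega_0 .. omega_{n'-1} not in T, the others in T *)
  (n' <= n)%N -> (forall i : 'I_n, ~ T (omegan n i) <-> (i < n')%N) ->
  (* the chosen integers a_{i,j} *)
  (forall i, (i < n')%N ->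
     (dd C n' i)%:Z = \sum_(i <= j < n') a i j * (ssz C j)%:Z) ->
  ~ T l0 ->
  gen_flatness (fun i : 'I_n => rhoj C i) ->
  forall f : ZL n,
    (in_ZT T f /\ I_sc C f) <-> gen_ideal (in_ZT T) (gens_h C n' a l0) f.
Proof.
move=> finC T0 TB T_index2 T_root n'_le T_omega bezout Tl0 flat f.
have subT : is_subgroup T by split.
have hom_h g : gens_h C n' a l0 g -> homogeneous T 0 g by apply: gens_h_homogeneous.
rewrite -(gen_ideal_in_ZT f subT hom_h); split=> -[Tf If]; split=> //.
  move/(I_scP finC): If; move/in_ZTE: Tf.
  exact: homogeneous_rho_ideal_in_h_ideal.
apply/(I_scP finC); apply: gen_ideal_sub (ideal_of_is_ideal _ _) _ If => g.
exact: gens_h_rho_ideal.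
Qed.
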